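(* Suppose that $A(s):(s,U)\mapsto U(s)$, $s\in\mathbb{R}$, $U\in\widetilde V$, is a one-parameter group acting on $\widetilde V=H^1(\mathbb{R},\mathbb{C})\times\mathbb{R}$ and preserving the one-form $\alpha$: $$A(s)^*\alpha=\alpha .$$ Then $$F(u,t)\defeq\alpha_{(u,t)}\left(\frac{d}{ds}A(s)(u,t)\Big|_{s=0}\right),\qquad (u,t)\in\widetilde V,$$ where $\defeq$ denotes equality by definition, is conserved by the flow of the nonlinear Schrödinger equation $$iu_t=-\tfrac12\partial_x^2u-|u|^{p-1}u ,$$ that is, $F(u(t),t)$ is constant in $t$ along solutions $t\mapsto u(t)$.
   Context: $V=H^1(\mathbb{R},\mathbb{C})$ is viewed as a real Hilbert space, with the symplectic form $\omega(u,v)=\mathrm{Im}\int u\bar v\,dx$. The Hamiltonian is $H(u)=\int\left(\tfrac14|\partial_xu|^2-\tfrac1{p+1}|u|^{p+1}\right)dx$, where $p$ is the exponent appearing in the equation. On $\widetilde V=V\times\mathbb{R}$ the one-form $\alpha$ is $$\alpha_{(u,t)}(v,T)=\tfrac12\omega(u,v)-H(u)T,\qquad (v,T)\in T_{(u,t)}\widetilde V .$$ For a map $f$ of $\widetilde V$ with differential $f_*$, the pullback is $(f^*\alpha)_{(u,t)}(v,T)=\alpha_{f(u,t)}(f_*(v,T))$. The differential calculus on the infinite-dimensional space $\widetilde V$ is treated formally: no regularity conditions on the group action or on the solutions are specified.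
   Formalization: The calculus, formal in the source, is made rigorous: p ≥ 1, u(t) is differentiable into H^1 on an open interval, and (s,t) ↦ A(s)(u(t),t) is C^1 near s = 0 with t-derivative given by A(s)_* of the velocity of (u(t),t). *)

(* Defs.v *)
From HB Require Import structures.
From mathcomp Require Import all_boot all_order all_algebra ring_quotient.
From mathcomp Require Import complex ring lra.
From mathcomp Require Import all_classical all_reals all_analysis.
From mathcomp Require Import measurable_realfun.
Import Order.TTheory GRing.Theory Num.Theory.
Import numFieldNormedType.Exports.

Set Implicit Arguments.
Unset Strict Implicit.
Unset Printing Implicit Defensive.

Local Open Scope ring_scope.
Local Open Scope complex_scope.
Local Open Scope classical_set_scope.

Local Notation Re := (@complex.Re _).
Local Notation Im := (@complex.Im _).
Local Notation modulus := (@Normc.normc _).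

Section integration.
Context {R : realType}.
Local Notation mu := (@lebesgue_measure R).
Implicit Types (f g : R -> R[i]) (phi : R -> R).

Definition cintegral f : R[i] :=
  (\int[mu]_x Re (f x)) +i* (\int[mu]_x Im (f x)).

Definition L2 f : Prop :=
  (Re \o f \in Lfun mu 2%:E) /\ (Im \o f \in Lfun mu 2%:E).

(* C^1 with compact support; C^oo ones would give the same weak derivatives. *)
Definition test_function phi : Prop :=
  [/\ forall x, derivable phi x 1,
      continuous (derive1 phi)
    & exists M : R, forall x, M < `|x| -> phi x = 0].

Definition weak_derivative f g : Prop :=
  forall phi, test_function phi ->
    cintegral (fun x => (derive1 phi x)%:C * f x) =
    - cintegral (fun x => (phi x)%:C * g x).

Definition H1_pair f g : Prop := [/\ L2 f, L2 g & weak_derivative f g].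

End integration.

Section square_integrable.
Context {R : realType}.
Local Notation mu := (@lebesgue_measure R).
Implicit Types (f g : R -> R[i]) (phi : R -> R).

Lemma Lfun2D (f g : R -> R) : f \in Lfun mu 2%:E -> g \in Lfun mu 2%:E ->
  (fun x => f x + g x) \in Lfun mu 2%:E.
Proof.
move=> hf hg.
exact: (@LfunP _ _ _ mu 2%:E (@lee1n R 2) (Lfun_Sub _ hf + Lfun_Sub _ hg)).
Qed.

Lemma Lfun2Z a (f : R -> R) : f \in Lfun mu 2%:E ->
  (fun x => a * f x) \in Lfun mu 2%:E.
Proof.
move=> hf.
have := @Lfun_scale _ _ _ mu f a 2 _ hf.
rewrite (_ : a \o* f = fun x => a * f x); first by apply; rewrite ler1n.
by apply/funext => x /=; rewrite mulrC.
Qed.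

Lemma L2D (f g : R -> Rcomplex R) : L2 f -> L2 g -> L2 (f + g).
Proof.
move=> [fr fi] [gr gi]; split.
  rewrite (_ : _ \o _ = fun x => Re (f x) + Re (g x)); first exact: Lfun2D.
  by apply/funext => x /=; rewrite fctE; case: (f x) (g x) => ? ? [].
rewrite (_ : _ \o _ = fun x => Im (f x) + Im (g x)); first exact: Lfun2D.
by apply/funext => x /=; rewrite fctE; case: (f x) (g x) => ? ? [].
Qed.

Lemma L2Z a (f : R -> Rcomplex R) : L2 f -> L2 (a *: f).
Proof.
move=> [fr fi]; split.
  rewrite (_ : _ \o _ = fun x => a * Re (f x)); first exact: Lfun2Z.
  by apply/funext => x /=; rewrite fctE; case: (f x).
rewrite (_ : _ \o _ = fun x => a * Im (f x)); first exact: Lfun2Z.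
by apply/funext => x /=; rewrite fctE; case: (f x).
Qed.

Lemma Lfun2M_int (f g : R -> R) : f \in Lfun mu 2%:E -> g \in Lfun mu 2%:E ->
  mu.-integrable setT (EFin \o (fun x => f x * g x)).
Proof. by move=> hf hg; apply/Lfun1_integrable; exact: Lfun2_mul_Lfun1. Qed.

Lemma continuous_compact_supp_Lfun2 phi (M : R) : continuous phi ->
  (forall x, M < `|x| -> phi x = 0) -> phi \in Lfun mu 2%:E.
Proof.
move=> cphi phi0.
have mphi : measurable_fun setT phi by exact: continuous_measurable_fun.
rewrite inE; apply/andP; split; rewrite inE//=.
rewrite /finite_norm unlock /=; apply: poweR_lty.
have -> : (\int[mu]_x `|(phi x)%:E| `^ 2 =
          \int[mu]_(x in `[(- M)%R, M%R]) (phi x ^+ 2)%:E)%E.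
  rewrite [RHS]integral_mkcond; apply: eq_integral => x _.
  rewrite patchE; case: ifPn => [_|].
    by rewrite /= powR_mulrn// real_normK// num_real.
  rewrite notin_setE /= in_itv /= => /negP.
  rewrite -ler_norml -ltNge => /phi0 ->.
  by rewrite /= normr0 powR0.
have /integrableP[_] : mu.-integrable `[- M, M] (EFin \o (fun x => phi x ^+ 2)).
  apply: continuous_compact_integrable; first exact: segment_compact.
  apply: continuous_subspaceT => x.
  apply: (@continuous_comp _ _ _ phi (fun y => y ^+ 2)); first exact: cphi.
  exact: exprn_continuous.
apply: le_lt_trans; rewrite le_eqVlt; apply/orP; left; apply/eqP.
by apply: eq_integral => x _ /=; rewrite ger0_norm// sqr_ge0.
Qed.

Lemma test_function_Lfun2 phi : test_function phi ->
  phi \in Lfun mu 2%:E /\ derive1 phi \in Lfun mu 2%:E.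
Proof.
move=> [dphi cphi [M phi0]]; split.
  apply: (@continuous_compact_supp_Lfun2 _ M) => // x.
  by apply/differentiable_continuous/derivable1_diffP.
apply: (@continuous_compact_supp_Lfun2 _ M) => // x Mx.
rewrite derive1E (@near_eq_derive _ _ _ _ (cst 0)) ?derive_cst//.
have : \forall y \near x, M < `|y|.
  have : (fun y : R => `|y|) @ x --> `|x| by exact: norm_continuous.
  by move/(_ _ (lt_nbhsr Mx)).
by apply: filterS => y /phi0.
Qed.

End square_integrable.

Section H1_closed.
Context {R : realType}.
Local Notation mu := (@lebesgue_measure R).
Implicit Types (psi : R -> R) (f g : R -> Rcomplex R).

Lemma cintegralM psi (f : R -> R[i]) :
  cintegral (fun x => (psi x)%:C * f x) =
  (\int[mu]_x (psi x * Re (f x))) +i* (\int[mu]_x (psi x * Im (f x))).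
Proof.
congr (_ +i* _); apply: eq_Rintegral => x _; case: (f x) => a b /=.
  by rewrite mul0r subr0.
by rewrite mul0r addr0.
Qed.

Lemma cintegral_lin psi a f g : psi \in Lfun mu 2%:E -> L2 f -> L2 g ->
  cintegral (fun x => (psi x)%:C * (a *: f + g) x) =
  a%:C * cintegral (fun x => (psi x)%:C * f x) +
  cintegral (fun x => (psi x)%:C * g x).
Proof.
move=> hp [fr fi] [gr gi].
have lin (u v : R -> R) : u \in Lfun mu 2%:E -> v \in Lfun mu 2%:E ->
    \int[mu]_x (a * (psi x * u x) + psi x * v x) =
    a * \int[mu]_x (psi x * u x) + \int[mu]_x (psi x * v x).
  move=> hu hv; rewrite RintegralD//.
  - by rewrite RintegralZl//; exact: Lfun2M_int.
  - rewrite (_ : EFin \o _ = EFin \o (fun x => psi x * (a * u x))).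
      by apply: Lfun2M_int => //; exact: Lfun2Z.
    by apply/funext => x /=; rewrite mulrCA.
  - exact: Lfun2M_int.
rewrite !cintegralM /=.
have -> : \int[mu]_x (psi x * Re ((a *: f + g) x)) =
    \int[mu]_x (a * (psi x * Re (f x)) + psi x * Re (g x)).
  apply: eq_Rintegral => x _; rewrite !fctE.
  by case: (f x) (g x) => ? ? [] ? ? /=; rewrite mulrDr mulrCA.
have -> : \int[mu]_x (psi x * Im ((a *: f + g) x)) =
    \int[mu]_x (a * (psi x * Im (f x)) + psi x * Im (g x)).
  apply: eq_Rintegral => x _; rewrite !fctE.
  by case: (f x) (g x) => ? ? [] ? ? /=; rewrite mulrDr mulrCA.
rewrite (lin _ _ fr gr) (lin _ _ fi gi).
by apply/eqP; rewrite eq_complex /= !mul0r subr0 addr0 !eqxx.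
Qed.

(* [Rcomplex R] is [R[i]] seen as a vector space over [R]. *)
Definition H1_pred : {pred ((R -> Rcomplex R) * (R -> Rcomplex R))%type} :=
  fun w => `[< H1_pair w.1 w.2 >].

Lemma H1_submod_closed : submod_closed H1_pred.
Proof.
split=> [|a [f f'] [g g']].
  have L0 : L2 (0 : R -> Rcomplex R).
    by split; exact: (@LfunP _ _ _ mu 2%:E (@lee1n R 2) 0).
  apply/asboolP; split=> //.
  move=> phi _; rewrite !cintegralM.
  have Z (psi : R -> R) : \int[mu]_x (psi x * 0) = 0.
    by under eq_Rintegral do rewrite mulr0; rewrite Rintegral_cst// mul0r.
  by rewrite /= !Z; apply/eqP; rewrite eq_complex /= oppr0 eqxx.
rewrite /in_mem/= => /asboolP[/= f2 f'2 ff'] /asboolP[/= g2 g'2 gg'].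
apply/asboolP; split=> /=; [by apply: L2D => //; exact: L2Z..|].
move=> phi tphi; have [p2 dp2] := test_function_Lfun2 tphi.
by rewrite !cintegral_lin// (ff' _ tphi) (gg' _ tphi) mulrN -opprD.
Qed.

HB.instance Definition _ :=
  GRing.isSubmodClosed.Build _ _ H1_pred H1_submod_closed.

Record H1_rep := H1Rep { H1_val :> (R -> Rcomplex R) * (R -> Rcomplex R);
  H1_valP : H1_val \in H1_pred }.

HB.instance Definition _ := [isSub for H1_val].
HB.instance Definition _ := [Choice of H1_rep by <:].
HB.instance Definition _ := [SubChoice_isSubLmodule of H1_rep by <:].

Definition H1_null : {pred H1_rep} := fun w =>
  `[< {ae mu, forall x, (val w).1 x = 0 /\ (val w).2 x = 0} >].

Lemma H1_null_zmod_closed : zmod_closed H1_null.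
Proof.
split=> [|v w /asboolP hv /asboolP hw].
  by apply/asboolP; apply/nearW.
apply/asboolP; move: hv hw.
apply: filterS2; first exact: (ae_filter_ringOfSetsType mu).
move=> x [v1 v2] [w1 w2].
by split; rewrite raddfB/= !fctE (v1,v2) (w1,w2) subr0.
Qed.
HB.instance Definition _ :=
  GRing.isZmodClosed.Build _ H1_null H1_null_zmod_closed.


Lemma H1_nullP (w : H1_rep) : reflect
  {ae mu, forall x, (val w).1 x = 0 /\ (val w).2 x = 0} (w \in H1_null).
Proof. exact: asboolP. Qed.

Lemma H1_nullZ a w : w \in H1_null -> a *: w \in H1_null.
Proof.
move/H1_nullP => hw; apply/H1_nullP; move: hw.
apply: filterS; first exact: (ae_filter_ringOfSetsType mu).
by move=> x [w1 w2]; rewrite linearZ/= !fctE w1 w2 scaler0.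
Qed.

End H1_closed.
Arguments H1_rep R : clear implicits.

Section H1.
Local Open Scope quotient_scope.
Context {R : realType}.
Local Notation mu := (@lebesgue_measure R).

(* An element of H^1(R, C) is a square-integrable function together with its
   weak derivative, both taken up to almost everywhere equality; the second
   component is determined by the first. *)
Definition H1 : Type := {ideal_quot (@H1_null R)}.
HB.instance Definition _ := GRing.Zmodule.on H1.
HB.instance Definition _ := EqQuotient.on H1.

Definition H1_class (w : H1_rep R) : H1 := \pi w.
Definition H1_repr (u : H1) : H1_rep R := repr u.

Lemma H1_classK u : H1_class (H1_repr u) = u. Proof. exact: reprK. Qed.

Lemma H1_classP v w : reflect (H1_class v = H1_class w) (v - w \in H1_null).
Proof. by rewrite Quotient.idealrBE; exact: eqP. Qed.

Lemma H1_classD v w : H1_class (v + w) = H1_class v + H1_class w.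
Proof. exact: Quotient.pi_add. Qed.

Definition H1_scale (a : R) (u : H1) : H1 := H1_class (a *: H1_repr u).

Lemma H1_classZ a w : H1_class (a *: w) = H1_scale a (H1_class w).
Proof.
apply/H1_classP; rewrite -scalerBr; apply: H1_nullZ.
by apply/H1_classP; rewrite H1_classK.
Qed.

Lemma H1_scaleA a b u : H1_scale a (H1_scale b u) = H1_scale (a * b) u.
Proof. by rewrite -(H1_classK u) -!H1_classZ scalerA. Qed.
Lemma H1_scale1 : left_id 1 H1_scale.
Proof. by move=> u; rewrite -(H1_classK u) -H1_classZ scale1r. Qed.
Lemma H1_scaleDr : right_distributive H1_scale +%R.
Proof.
move=> a u v; rewrite -(H1_classK u) -(H1_classK v).
by rewrite -H1_classD -!H1_classZ -H1_classD scalerDr.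
Qed.
Lemma H1_scaleDl u : {morph H1_scale^~ u : a b / a + b}.
Proof.
by move=> a b; rewrite -(H1_classK u) -!H1_classZ -H1_classD scalerDl.
Qed.
HB.instance Definition _ := GRing.Zmodule_isLmodule.Build R H1
  H1_scaleA H1_scale1 H1_scaleDr H1_scaleDl.

(* Chosen representatives; every use below is insensitive to the choice. *)
Definition H1_fun (u : H1) : R -> R[i] := (val (H1_repr u)).1.
Definition H1_deriv (u : H1) : R -> R[i] := (val (H1_repr u)).2.

End H1.
Arguments H1 R : clear implicits.

Section H1_norm.
Context {R : realType}.
Local Notation mu := (@lebesgue_measure R).
Implicit Types (v w z : H1_rep R) (u : H1 R).

Definition rep_density v w (x : R) : R :=
  Re (((val v).1 x : R[i]) * ((val w).1 x : R[i])^* +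
      ((val v).2 x : R[i]) * ((val w).2 x : R[i])^*).

Lemma rep_densityE v w x : rep_density v w x =
  (Re ((val v).1 x) * Re ((val w).1 x) + Im ((val v).1 x) * Im ((val w).1 x)) +
  (Re ((val v).2 x) * Re ((val w).2 x) + Im ((val v).2 x) * Im ((val w).2 x)).
Proof.
rewrite /rep_density; case: ((val v).1 x) ((val w).1 x) => a b [c d].
by case: ((val v).2 x) ((val w).2 x) => e f [g h] /=; rewrite !mulrN !opprK.
Qed.

Lemma rep_density_integrable v w :
  mu.-integrable setT (EFin \o rep_density v w).
Proof.
have /asboolP[[v1 v2] [v3 v4] _] := valP v.
have /asboolP[[w1 w2] [w3 w4] _] := valP w.
have -> : EFin \o rep_density v w =
  ((EFin \o (fun x => (Re \o (val v).1) x * (Re \o (val w).1) x)) \+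
   (EFin \o (fun x => (Im \o (val v).1) x * (Im \o (val w).1) x))) \+
  ((EFin \o (fun x => (Re \o (val v).2) x * (Re \o (val w).2) x)) \+
   (EFin \o (fun x => (Im \o (val v).2) x * (Im \o (val w).2) x))).
  by apply/funext => x /=; rewrite rep_densityE !EFinD.
by do 2! apply: integrableD => //; exact: Lfun2M_int.
Qed.

Definition rep_inner v w : R := \int[mu]_x rep_density v w x.

Lemma rep_innerC v w : rep_inner v w = rep_inner w v.
Proof.
apply: eq_Rintegral => x _; rewrite !rep_densityE.
by rewrite ![_ ((val v).1 x) * _]mulrC ![_ ((val v).2 x) * _]mulrC.
Qed.

Lemma rep_inner_lin a v w z :
  rep_inner (a *: v + w) z = a * rep_inner v z + rep_inner w z.
Proof.
rewrite /rep_inner -RintegralZl//; last exact: rep_density_integrable.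
rewrite -RintegralD//; last 2 first.
- rewrite (_ : EFin \o _ = fun x => (a%:E * (EFin \o rep_density v z) x)%E)//.
  by apply: integrableZl => //; exact: rep_density_integrable.
- exact: rep_density_integrable.
apply: eq_Rintegral => x _; rewrite !rep_densityE linearP/= !fctE.
case: ((val v).1 x) ((val w).1 x) => ? ? [? ?].
case: ((val v).2 x) ((val w).2 x) => ? ? [? ?] /=.
ring.
Qed.

Lemma rep_density_ge0 v x : 0 <= rep_density v v x.
Proof. by rewrite rep_densityE -!expr2 !addr_ge0 ?sqr_ge0. Qed.

Lemma rep_inner_ge0 v : 0 <= rep_inner v v.
Proof. by apply: Rintegral_ge0 => x _; exact: rep_density_ge0. Qed.

Lemma rep_inner_null v w : v \in H1_null -> rep_inner v w = 0.
Proof.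
move=> /H1_nullP v0; rewrite /rep_inner /Rintegral.
rewrite (ae_eq_integral (cst 0%E))//; first by rewrite integral0.
- by have /integrableP[] := rep_density_integrable v w.
- apply: (@filterS _ _ (ae_filter_ringOfSetsType mu) _ _ _ v0).
  by move=> x [vx1 vx2] _ /=; rewrite rep_densityE vx1 vx2 /= !mul0r !addr0.
Qed.

Lemma rep_inner_eq0 v : rep_inner v v = 0 -> v \in H1_null.
Proof.
move=> v0; have /integrableP[mv _] := rep_density_integrable v v.
have : (\int[mu]_x `|(rep_density v v x)%:E| = 0)%E.
  under eq_integral do rewrite gee0_abs ?lee_fin ?rep_density_ge0//.
  have := rep_density_integrable v v.
  by move/integrable_fin_num => /(_ measurableT) /fineK <-; congr EFin.
move/(ae_eq_integral_abs mu measurableT mv) => hv; apply/H1_nullP.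
apply: (@filterS _ _ (ae_filter_ringOfSetsType mu) _ _ _ hv).
move=> x /(_ I) [] /eqP; rewrite rep_densityE -!expr2.
rewrite !paddr_eq0 ?addr_ge0 ?sqr_ge0// !sqrf_eq0.
move=> /andP[/andP[/eqP a0 /eqP b0] /andP[/eqP c0 /eqP d0]].
by split; apply/eqP; rewrite eq_complex /= ?a0 ?b0 ?c0 ?d0 !eqxx.
Qed.

End H1_norm.

Section inner_norm.
Context {R : realType} {V : lmodType R} (B : V -> V -> R).
Hypothesis BC : forall v w, B v w = B w v.
Hypothesis Blin : forall a v w z, B (a *: v + w) z = a * B v z + B w z.
Hypothesis Bge0 : forall v, 0 <= B v v.

Let BD v w : B (v + w) (v + w) = B v v + 2 * B v w + B w w.
Proof.
have D x y z : B (x + y) z = B x z + B y z.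
  by have := Blin 1 x y z; rewrite scale1r mul1r.
by rewrite D ![B _ (v + w)]BC !D [B w v]BC; ring.
Qed.

Let BZ a v w : B (a *: v) w = a * B v w.
Proof.
have B0 : B 0 w = 0.
  by have := Blin 1 0 0 w; rewrite scale1r addr0 mul1r; lra.
by rewrite -[a *: v]addr0 Blin B0 addr0.
Qed.

Lemma inner_CS v w : B v w ^+ 2 <= B v v * B w w.
Proof.
have P a : 0 <= a ^+ 2 * B v v + 2 * (a * B v w) + B w w.
  have := Bge0 (a *: v + w).
  by rewrite BD !BZ [B v (a *: v)]BC BZ mulrA -expr2.
have [v0|v0] := eqVneq (B v v) 0.
  rewrite v0 mul0r; have [->|vw0] := eqVneq (B v w) 0; first by rewrite expr0n.
  have := P (- (B w w + 1) / (2 * B v w)); rewrite v0 mulr0 add0r.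
  rewrite (_ : 2 * _ = - (B w w + 1)); last by field.
  by move=> h; exfalso; move: h; rewrite opprD addrAC addNr; lra.
have := P (- B v w / B v v).
rewrite (_ : _ + _ = (B v v * B w w - B v w ^+ 2) / B v v); last by field.
by rewrite pmulr_lge0 ?subr_ge0// invr_gt0 lt_def v0 Bge0.
Qed.

Lemma inner_triangle v w :
  Num.sqrt (B (v + w) (v + w)) <= Num.sqrt (B v v) + Num.sqrt (B w w).
Proof.
rewrite -[leRHS]ger0_norm ?addr_ge0 ?sqrtr_ge0// -sqrtr_sqr ler_wsqrtr//.
rewrite BD sqrrD !sqr_sqrtr// lerD2r lerD2l.
rewrite -[leRHS]mulr_natl ler_pM2l// -sqrtrM//.
by rewrite (le_trans (ler_norm _))// -sqrtr_sqr ler_wsqrtr// inner_CS.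
Qed.

Lemma inner_normZ a v :
  Num.sqrt (B (a *: v) (a *: v)) = `|a| * Num.sqrt (B v v).
Proof.
by rewrite BZ BC BZ mulrA -expr2 sqrtrM ?sqr_ge0// sqrtr_sqr.
Qed.
End inner_norm.

Section H1_normed.
Context {R : realType}.
Local Notation mu := (@lebesgue_measure R).
Implicit Types u v w z : H1 R.

Definition H1_inner u v : R :=
  Re (cintegral (fun x => H1_fun u x * (H1_fun v x)^* +
                         H1_deriv u x * (H1_deriv v x)^*)).

Lemma H1_innerE u v : H1_inner u v = rep_inner (H1_repr u) (H1_repr v).
Proof. by []. Qed.

Lemma H1_innerC u v : H1_inner u v = H1_inner v u.
Proof. by rewrite !H1_innerE rep_innerC. Qed.

Lemma H1_inner_lin a u v z :
  H1_inner (a *: u + v) z = a * H1_inner u z + H1_inner v z.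
Proof.
rewrite !H1_innerE -rep_inner_lin.
set r := a *: H1_repr u + H1_repr v.
have -> : H1_repr (a *: u + v) = 1 *: (H1_repr (a *: u + v) - r) + r.
  by rewrite scale1r subrK.
rewrite rep_inner_lin mul1r rep_inner_null ?add0r//.
by apply/H1_classP; rewrite H1_classK H1_classD H1_classZ !H1_classK.
Qed.

Lemma H1_inner_ge0 u : 0 <= H1_inner u u.
Proof. by rewrite H1_innerE rep_inner_ge0. Qed.

Definition H1_norm u : R := Num.sqrt (H1_inner u u).

Lemma H1_normD u v : H1_norm (u + v) <= H1_norm u + H1_norm v.
Proof.
exact: (inner_triangle H1_innerC H1_inner_lin H1_inner_ge0).
Qed.

Lemma H1_normZ a u : H1_norm (a *: u) = `|a| * H1_norm u.
Proof.
exact: (inner_normZ H1_innerC H1_inner_lin).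
Qed.

Lemma H1_norm_eq0 u : H1_norm u = 0 -> u = 0.
Proof.
move=> /eqP; rewrite sqrtr_eq0 => u0.
have {u0} : rep_inner (H1_repr u) (H1_repr u) = 0.
  by apply/eqP; rewrite eq_le rep_inner_ge0 andbT.
move/rep_inner_eq0 => u0; rewrite -[u]H1_classK.
have <- : H1_class 0 = 0 :> H1 R.
  by rewrite -(scale0r (0 : H1_rep R)) H1_classZ; exact: scale0r.
by apply/H1_classP; rewrite subr0.
Qed.

HB.instance Definition _ :=
  Lmodule_isNormed.Build R (H1 R) H1_normD H1_normZ H1_norm_eq0.

End H1_normed.

Notation phase_time R := (H1 R * R)%type.

Section nls.
Context {R : realType}.
Local Notation mu := (@lebesgue_measure R).
Implicit Types (p : R) (A : R -> phase_time R -> phase_time R).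
Implicit Types (u : R -> H1 R) (I : set R).

Definition omega (v w : H1 R) : R :=
  Im (cintegral (fun x => H1_fun v x * (H1_fun w x)^*)).

Definition energy p (v : H1 R) : R :=
  \int[mu]_x (4^-1 * modulus (H1_deriv v x) ^+ 2 -
              (p + 1)^-1 * modulus (H1_fun v x) `^ (p + 1)).

Definition alpha p (U W : phase_time R) : R :=
  2^-1 * omega U.1 W.1 - energy p U.1 * W.2.

(* The differential f_* W at U is the directional derivative of f along W;
   it agrees with 'd f U W wherever f is Frechet differentiable, and still makes
   sense for maps such as (v, t) |-> v(. - s t), which are differentiable at
   smooth v only in this weaker sense. *)
Definition pullback (f : phase_time R -> phase_time R)
    (a : phase_time R -> phase_time R -> R) (U W : phase_time R) : R :=
  a (f U) ('D_W f U).

Definition preserves (f : phase_time R -> phase_time R)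
    (a : phase_time R -> phase_time R -> R) : Prop :=
  forall U W, derivable f U W -> pullback f a U W = a U W.

Definition one_parameter_group A : Prop :=
  (forall U, A 0 U = U) /\ (forall s1 s2 U, A (s1 + s2) U = A s1 (A s2 U)).

Definition noether_charge p A (U : phase_time R) : R :=
  alpha p U ('D_1 (fun s => A s U) 0).

(* The equation i w = - 1/2 v_xx - |v|^(p-1) v, almost everywhere; since v and w
   lie in H^1, the distribution v_xx it determines is a square-integrable
   function. *)
Definition nls_equation p (v w : H1 R) : Prop :=
  exists2 vxx : R -> R[i], H1_pair (H1_deriv v) vxx &
    {ae mu, forall x, 'i%C * H1_fun w x =
      - (2^-1)%:C * vxx x
      - (modulus (H1_fun v x) `^ (p - 1))%:C * H1_fun v x}.

Definition nls_solution p I u : Prop :=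
  forall t, I t -> derivable u t 1 /\ nls_equation p (u t) ('D_1 u t).

Definition trajectory u (t : R) : phase_time R := (u t, t).

(* The map (s, t) |-> A(s)(u(t), t) is continuously differentiable near {0} x I,
   and its t-derivative is A(s)_* applied to the velocity of the trajectory.
   Both hold as soon as A is jointly of class C^1 and u is of class C^1; but
   only the orbits through the trajectory are constrained, so that actions such
   as translations, whose generator is not defined on all of H^1, are
   allowed. *)
Definition regular_along A I u : Prop :=
  forall t0, I t0 -> \forall q \near ((0, t0) : R * R),
    [/\ derivable (fun s => A s (trajectory u q.2)) q.1 1,
        derivable (fun t => A q.1 (trajectory u t)) q.2 1,
        {for q, continuous (fun q' : R * R =>
           'D_1 (fun s => A s (trajectory u q'.2)) q'.1)},
        {for q, continuous (fun q' : R * R =>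
           'D_1 (fun t => A q'.1 (trajectory u t)) q'.2)}
      & is_derive (trajectory u q.2) ('D_1 (trajectory u) q.2) (A q.1)
          ('D_1 (fun t => A q.1 (trajectory u t)) q.2)].

End nls.

(* Main.v *)
Require Import Defs.
From mathcomp Require Import all_boot all_order all_algebra.
From mathcomp Require Import all_classical all_reals all_analysis.
From mathcomp Require Import measurable_realfun.
From mathcomp Require Import complex ring lra.
Import Order.TTheory GRing.Theory Num.Theory.
Import numFieldNormedType.Exports.

(** Along a solution put g(s, t) = A(s)(u(t), t). The invariance of the form says
    that alpha(g_t) does not depend on s, and the charge F is alpha(g_s) at s = 0.
    Formally, dF/dt is therefore the exterior derivative of alpha on (g_t, g_s) at
    s = 0. If g_s = (v, T) there, this is
    omega(u_t, v) + dH(v) - dH(u_t) T,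
    and the Schroedinger equation says that the differential dH of the energy at u
    is - omega(u_t, .), so everything cancels.

    The mixed derivative of g is not available, as g is only of class C^1, so the
    exterior derivative is replaced by circulations around small squares in the
    (s, t) plane. The integral of alpha over a side from P to Q is replaced by
    [edge P Q], the form at P on the chord Q - P. The two sides in the direction of
    t cancel up to o(s^2) by invariance ([edge_defect]), and the circulation around
    the whole square of side s is o(s^2) by the equation ([square_defect]). Summing
    over a column of squares and letting s tend to 0 shows that F varies by
    o(t2 - t1) near each time t0 ([infinitesimal_conservation]); hence its derivative
    vanishes and F is constant on the interval. The first order expansions of g come
    from a mean value inequality in H^1 x R ([phase_mean_value]).

    The analytic input is that the energy is strictly differentiable at u with
    differential - omega(u_t, .) ([energy_estimate]). The kinetic part needs an
    integration by parts for weak derivatives ([weak_integration_by_parts]), the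
    potential part a pointwise estimate ([potential_estimate]) and the Sobolev
    embedding of H^1 into the bounded functions ([H1_sup]). Integration by parts and
    the embedding both rest on one estimate: at a Lebesgue point x, a function
    differs from its mollification of width e by at most the integral of its
    derivative near x ([mollify_approx]). Together with the Tonelli theorem in a thin
    band around the diagonal, this makes the errors of order e. *)

Set Implicit Arguments.
Unset Strict Implicit.
Unset Printing Implicit Defensive.

Local Open Scope ring_scope.
Local Open Scope classical_set_scope.

(** * Cubic and quadratic splines *)

Section spline.
Context {R : realType}.
Implicit Types (x y e : R) (n : nat).

(** The truncated power: the n-th power of the positive part of x. *)
Definition tpow n x : R := Num.max 0 x ^+ n.

Lemma tpow_ge0 n x : 0 <= x -> tpow n x = x ^+ n.
Proof. by move=> x0; rewrite /tpow max_r. Qed.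

Lemma tpow_le0 n x : x <= 0 -> tpow n.+1 x = 0.
Proof. by move=> x0; rewrite /tpow max_l// expr0n. Qed.

Lemma continuous_tpow n : continuous (tpow n).
Proof.
move=> x; apply: (@continuous_comp _ _ _ (fun y => Num.max 0 y) (fun y => y ^+ n)).
  by apply: continuous_max; [exact: cst_continuous|exact: cvg_id].
exact: exprn_continuous.
Qed.

Global Instance is_derive_tpow n x :
  is_derive x 1 (tpow n.+2) (n.+2%:R * tpow n.+1 x).
Proof.
have [x0|x0|<-] := ltgtP 0 x.
- rewrite tpow_ge0 ?ltW//.
  apply: (@near_eq_is_derive _ _ _ (fun y => y ^+ n.+2)).
  + near=> y; rewrite tpow_ge0// ltW//; near: y; exact: lt_nbhsr.
  + rewrite (_ : _ ^~ _ = id ^+ n.+2); last by apply/funext => y; rewrite exprfctE.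
    by apply: is_derive_eq; rewrite /GRing.scale/= mulr1.
- rewrite tpow_le0 ?ltW// mulr0.
  apply: (@near_eq_is_derive _ _ _ (cst 0)).
  near=> y; rewrite tpow_le0// ltW//; near: y; exact: lt_nbhsl.
- rewrite tpow_le0// mulr0; apply/is_derive1_caratheodory.
  exists (tpow n.+1); split; last exact: tpow_le0.
    move=> z; rewrite subr0 (tpow_le0 n.+1 (lexx 0)) subr0.
    have [hp|hn] := leP 0 z; first by rewrite !tpow_ge0// exprSr.
    by rewrite !tpow_le0 ?ltW// mul0r.
  exact: continuous_tpow.
Unshelve. all: by end_near.
Qed.

(** Splines with the knots -3, -1, 1, 3: [spline_step] is a smoothed Heaviside
    step, its derivative [spline_bump] is an even bump of integral 1 supported
    between -3 and 3, and [spline_dbump] is the continuous derivative of the bump. *)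
Definition spline_step x : R := 48^-1 *
  (tpow 3 (x + 3) - 3 * tpow 3 (x + 1) + 3 * tpow 3 (x - 1) - tpow 3 (x - 3)).
Definition spline_bump x : R := 16^-1 *
  (tpow 2 (x + 3) - 3 * tpow 2 (x + 1) + 3 * tpow 2 (x - 1) - tpow 2 (x - 3)).
Definition spline_dbump x : R := 8^-1 *
  (tpow 1 (x + 3) - 3 * tpow 1 (x + 1) + 3 * tpow 1 (x - 1) - tpow 1 (x - 3)).

Global Instance is_derive_tpow_shift n x a :
  is_derive x 1 (fun y => tpow n.+2 (y + a)) (n.+2%:R * tpow n.+1 (x + a)).
Proof.
have h : is_derive x 1 (fun y => y + a) (1 : R).
  by apply: is_derive_eq; rewrite addr0.
rewrite -[X in is_derive _ _ _ X]mulr1.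
exact: (@is_derive1_comp _ (tpow n.+2) (fun y => y + a)).
Qed.

Global Instance is_derive_spline_step x : is_derive x 1 spline_step (spline_bump x).
Proof.
apply: is_derive_eq.
rewrite /spline_bump /GRing.scale /=; lra.
Qed.

Global Instance is_derive_spline_bump x : is_derive x 1 spline_bump (spline_dbump x).
Proof.
apply: is_derive_eq.
rewrite /spline_dbump /GRing.scale /=; lra.
Qed.

Lemma continuous_spline_dbump : continuous spline_dbump.
Proof.
have c n a : continuous (fun y => tpow n (y + a)).
  move=> y; apply: (@continuous_comp _ _ _ (fun y => y + a) (tpow n)).
    by apply: cvgD; [exact: cvg_id|exact: cst_continuous].
  exact: continuous_tpow.
move=> x; rewrite /spline_dbump.
apply: cvgM; first exact: cst_continuous.
apply: cvgB; [apply: cvgD; [apply: cvgB|]|]; try exact: c;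
  by apply: cvgM; [exact: cst_continuous|exact: c].
Qed.

Lemma continuous_spline_bump : continuous spline_bump.
Proof.
by move=> x; apply/differentiable_continuous/derivable1_diffP.
Qed.

Lemma continuous_spline_step : continuous spline_step.
Proof.
by move=> x; apply/differentiable_continuous/derivable1_diffP.
Qed.

Lemma max0P x : (0 <= x /\ Num.max 0 x = x) \/ (x <= 0 /\ Num.max 0 x = 0).
Proof. by case: (leP 0 x) => h; [left|right; rewrite ltW]. Qed.

(* Splits the four truncated powers of a spline at x according to their signs. *)
Ltac casemax x := 
  case: (max0P (x + 3)) => -[? ->];
  case: (max0P (x + 1)) => -[? ->];
  case: (max0P (x - 1)) => -[? ->];
  case: (max0P (x - 3)) => -[? ->].

Lemma spline_stepl x : x <= -3 -> spline_step x = 0.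
Proof.
move=> x3; rewrite /spline_step /tpow.
have -> : Num.max 0 (x + 3) = 0 by apply/max_l; lra.
have -> : Num.max 0 (x + 1) = 0 by apply/max_l; lra.
have -> : Num.max 0 (x - 1) = 0 by apply/max_l; lra.
have -> : Num.max 0 (x - 3) = 0 by apply/max_l; lra.
ring.
Qed.

Lemma spline_stepr x : 3 <= x -> spline_step x = 1.
Proof.
move=> x3; rewrite /spline_step /tpow.
have -> : Num.max 0 (x + 3) = x + 3 by apply/max_r; lra.
have -> : Num.max 0 (x + 1) = x + 1 by apply/max_r; lra.
have -> : Num.max 0 (x - 1) = x - 1 by apply/max_r; lra.
have -> : Num.max 0 (x - 3) = x - 3 by apply/max_r; lra.
by field.
Qed.

Lemma spline_bump_itv x : 0 <= spline_bump x <= 1.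
Proof. by rewrite /spline_bump /tpow; casemax x; apply/andP; split; try lra; nra. Qed.

Lemma spline_step_itv x : 0 <= spline_step x <= 1.
Proof.
have mono : {homo spline_step : x y / x <= y}.
  move=> a b ab; apply: (@ger0_derive1_le_cc _ spline_step a b) => //.
  - by move=> z _; rewrite derive1E derive_val; case/andP: (spline_bump_itv z).
  - exact/continuous_subspaceT/continuous_spline_step.
  - by rewrite in_itv/= lexx.
  - by rewrite in_itv/= lexx andbT.
apply/andP; split.
  rewrite -(@spline_stepl (Num.min x (-3))) ?ge_min ?lexx ?orbT//.
  by apply: mono; rewrite ge_min lexx.
rewrite -(@spline_stepr (Num.max x 3)) ?le_max ?lexx ?orbT//.
by apply: mono; rewrite le_max lexx.
Qed.

Lemma spline_bump0 x : 3 <= `|x| -> spline_bump x = 0.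
Proof.
rewrite ler_normr /spline_bump /tpow => /orP h; casemax x; case: h => h; try lra; nra.
Qed.

Lemma spline_dbump0 x : 3 <= `|x| -> spline_dbump x = 0.
Proof.
rewrite ler_normr /spline_dbump /tpow => /orP h; casemax x; case: h => h; lra.
Qed.

Lemma spline_dbump_norm x : `|spline_dbump x| <= 1.
Proof. by rewrite ler_norml /spline_dbump /tpow; casemax x; lra. Qed.

Lemma spline_bumpN x : spline_bump (- x) = spline_bump x.
Proof.
rewrite /spline_bump /tpow.
rewrite (_ : - x + 3 = - (x - 3)); last by ring.
rewrite (_ : - x + 1 = - (x - 1)); last by ring.
rewrite (_ : - x - 1 = - (x + 1)); last by ring.
rewrite (_ : - x - 3 = - (x + 3)); last by ring.
have H y : Num.max 0 (- y) ^+ 2 = y ^+ 2 - Num.max 0 y ^+ 2.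
  case: (max0P y) => -[h ->]; case: (max0P (-y)) => -[h' ->]; nra.
rewrite !H; ring.
Qed.

End spline.

(** * Integrable and square-integrable functions on the line *)

Section integration_tools.
Context {R : realType}.
Local Notation mu := (@lebesgue_measure R).
Implicit Types (f g h : R -> R) (A : set R).

(** Integrability of a real function for the Lebesgue measure on the line. *)
Definition intble f : Prop := mu.-integrable setT (EFin \o f).

Lemma intbleD f g : intble f -> intble g -> intble (fun x => f x + g x).
Proof. by move=> hf hg; have := integrableD measurableT hf hg. Qed.

Lemma intbleZ c f : intble f -> intble (fun x => c * f x).
Proof. by move=> hf; have := integrableZl measurableT c hf. Qed.

Lemma intbleB f g : intble f -> intble g -> intble (fun x => f x - g x).
Proof. by move=> hf hg; have := integrableB measurableT hf hg. Qed.

Lemma intble_abs f : intble f -> intble (fun x => `|f x|).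
Proof. by move=> hf; have := integrable_abse hf. Qed.

Lemma intble_measurable f : intble f -> measurable_fun setT f.
Proof. by move=> /integrableP[/measurable_EFinP]. Qed.

Lemma intble_le f g : measurable_fun setT f -> intble g ->
  (forall x, `|f x| <= g x) -> intble f.
Proof.
move=> mf ig fg; apply: (le_integrable measurableT _ _ ig).
  exact/measurable_EFinP.
by move=> x _; rewrite /= lee_fin (le_trans (fg x))// ler_norm.
Qed.

Lemma Lfun2_measurable f : f \in Lfun mu 2%:E -> measurable_fun setT f.
Proof. by move/sub_Lfun_mfun; rewrite inE. Qed.

Lemma intbleM f g : f \in Lfun mu 2%:E -> g \in Lfun mu 2%:E ->
  intble (fun x => f x * g x).
Proof. exact: Lfun2M_int. Qed.

Lemma intble_sqr f : f \in Lfun mu 2%:E -> intble (fun x => f x ^+ 2).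
Proof. by move=> hf; exact: Lfun2M_int. Qed.

Lemma Lfun2_sqr f : measurable_fun setT f -> intble (fun x => f x ^+ 2) ->
  f \in Lfun mu 2%:E.
Proof.
move=> mf /integrableP[_ h].
rewrite inE; apply/andP; split; rewrite inE//=.
rewrite /finite_norm unlock /=; apply: poweR_lty; apply: le_lt_trans h.
rewrite le_eqVlt; apply/orP; left; apply/eqP.
apply: eq_integral => x _ /=.
by rewrite powR_mulrn// real_normK ?num_real// ger0_norm ?sqr_ge0.
Qed.

Lemma Lfun2_le f g : measurable_fun setT f -> g \in Lfun mu 2%:E ->
  (forall x, `|f x| <= `|g x|) -> f \in Lfun mu 2%:E.
Proof.
move=> mf g2 fg; apply: Lfun2_sqr => //; apply: (intble_le _ (intble_sqr g2)).
  exact: measurable_funX.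
by move=> x; rewrite normrX -(real_normK (num_real (g x))) lerXn2r ?nnegrE.
Qed.

Lemma Lfun2_abs f : f \in Lfun mu 2%:E -> (fun x => `|f x|) \in Lfun mu 2%:E.
Proof.
move=> f2; apply: (Lfun2_le _ f2) => [|x]; last by rewrite normr_id.
by apply: measurableT_comp => //; exact: Lfun2_measurable.
Qed.

Lemma Lfun2_indic A : measurable A -> (mu A < +oo)%E ->
  (\1_A : R -> R) \in Lfun mu 2%:E.
Proof.
move=> mA Aoo; apply: Lfun2_sqr; first exact: measurable_indic.
have -> : (fun x => \1_A x ^+ 2) = \1_A :> (R -> R).
  by apply/funext => x; rewrite indicE; case: (x \in A); rewrite ?expr1n ?expr0n.
apply/integrableP; split; first exact/measurable_EFinP/measurable_indic.
under eq_integral do rewrite /= ger0_norm//.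
by rewrite integral_indic// setIT.
Qed.

Lemma aeS (P Q : R -> Prop) : (forall x, P x -> Q x) ->
  {ae mu, forall x, P x} -> {ae mu, forall x, Q x}.
Proof. by move=> PQ; apply: filterS PQ; exact: (ae_filter_ringOfSetsType mu). Qed.

Lemma aeS2 (P Q S : R -> Prop) : (forall x, P x -> Q x -> S x) ->
  {ae mu, forall x, P x} -> {ae mu, forall x, Q x} -> {ae mu, forall x, S x}.
Proof. by move=> PQ; apply: filterS2 PQ; exact: (ae_filter_ringOfSetsType mu). Qed.

Lemma aeI (P Q : R -> Prop) : {ae mu, forall x, P x} -> {ae mu, forall x, Q x} ->
  {ae mu, forall x, P x /\ Q x}.
Proof. by apply: aeS2. Qed.

Lemma intble_le_ae f g : measurable_fun setT f -> intble g ->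
  {ae mu, forall x, `|f x| <= g x} -> intble f.
Proof.
move=> mf hg fg.
have g0 : {ae mu, forall x, `|f x| <= `|g x|}.
  by apply: aeS fg => x /le_trans; apply; exact: ler_norm.
apply/integrableP; split; first exact/measurable_EFinP.
have /integrableP[_] := intble_abs hg; apply: le_lt_trans.
apply: ae_ge0_le_integral => //.
- by do 2 apply: measurableT_comp => //.
- by do 3 apply: measurableT_comp => //; exact: intble_measurable.
- by apply: aeS g0 => x fx _; rewrite /= lee_fin normr_id.
Qed.

Lemma Rintegral_ae0_ge f : measurable_fun setT f ->
  {ae mu, forall x, 0 <= f x} -> 0 <= \int[mu]_x f x.
Proof.
move=> mf f0.
have -> : \int[mu]_x f x = \int[mu]_x `|f x|.
  congr fine; apply: ae_eq_integral => //.
  - exact/measurable_EFinP.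
  - by apply/measurable_EFinP; exact: measurableT_comp.
  - apply: aeS f0 => x fx _ /=; by rewrite ger0_norm.
by apply: Rintegral_ge0.
Qed.

Lemma le_Rintegral_ae f g : intble f -> intble g ->
  {ae mu, forall x, f x <= g x} -> \int[mu]_x f x <= \int[mu]_x g x.
Proof.
move=> hf hg fg; rewrite -subr_ge0 -RintegralB//.
apply: Rintegral_ae0_ge; first exact: intble_measurable (intbleB hg hf).
apply: aeS fg => x fx; rewrite subr_ge0; exact: fx.
Qed.

Lemma eq_Rintegral_ae f g : measurable_fun setT f -> measurable_fun setT g ->
  {ae mu, forall x, f x = g x} -> \int[mu]_x f x = \int[mu]_x g x.
Proof.
move=> mf mg fg; congr fine; apply: ae_eq_integral => //.
- exact/measurable_EFinP.
- exact/measurable_EFinP.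
- by apply: aeS fg => x fx _ /=; rewrite fx.
Qed.

Lemma norm_Rintegral_ae f g : measurable_fun setT f -> intble g ->
  {ae mu, forall x, `|f x| <= g x} -> `|\int[mu]_x f x| <= \int[mu]_x g x.
Proof.
move=> mf hg fg.
have hf : intble f by exact: intble_le_ae hg fg.
apply: le_trans (le_normr_Rintegral measurableT hf) _.
by apply: le_Rintegral_ae => //; exact: intble_abs.
Qed.

Lemma Cauchy_Schwarz f g : f \in Lfun mu 2%:E -> g \in Lfun mu 2%:E ->
  `|\int[mu]_x (f x * g x)| <=
    Num.sqrt (\int[mu]_x (f x ^+ 2)) * Num.sqrt (\int[mu]_x (g x ^+ 2)).
Proof.
move=> f2 g2.
set a := \int[mu]_x (f x ^+ 2); set b := \int[mu]_x (g x ^+ 2).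
set c := \int[mu]_x (f x * g x).
have a0 : 0 <= a by apply: Rintegral_ge0 => x _; exact: sqr_ge0.
have b0 : 0 <= b by apply: Rintegral_ge0 => x _; exact: sqr_ge0.
(* t^2 a + 2 t c + b is the integral of (t f + g)^2. *)
have P t : 0 <= t ^+ 2 * a + 2 * t * c + b.
  have -> : t ^+ 2 * a + 2 * t * c + b = \int[mu]_x ((t * f x + g x) ^+ 2).
    rewrite -!RintegralZl//; [|exact: intbleM|exact: intble_sqr].
    rewrite -!RintegralD//.
    - by apply: eq_Rintegral => x _; ring.
    - by apply: intbleD; apply: intbleZ; [exact: intble_sqr|exact: intbleM].
    - exact: intble_sqr.
    - by apply: intbleZ; exact: intble_sqr.
    - by apply: intbleZ; exact: intbleM.
  by apply: Rintegral_ge0 => x _; exact: sqr_ge0.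
suff h : c ^+ 2 <= a * b.
  by rewrite -sqrtrM// -sqrtr_sqr ler_wsqrtr.
have [a00|a00] := eqVneq a 0.
  have [->|c0] := eqVneq c 0; first by rewrite expr0n mulr_ge0.
  have := P (- (b + 1) / (2 * c)); rewrite a00 mulr0 add0r.
  rewrite (_ : 2 * _ * c = - (b + 1)); last by field.
  lra.
have := P (- c / a).
rewrite (_ : _ + _ = (a * b - c ^+ 2) / a); last by field.
by rewrite pmulr_lge0 ?subr_ge0// invr_gt0 lt_def a00.
Qed.

End integration_tools.

(** * Mollifiers and real weak derivatives *)

Section mollifier.
Context {R : realType}.
Local Notation mu := (@lebesgue_measure R).
Implicit Types (f g h : R -> R) (d e r x y z : R).

(** Real square-integrable functions f and g such that g is the weak derivative
    of f. *)
Definition weak_pair f g : Prop :=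
  [/\ f \in Lfun mu 2%:E, g \in Lfun mu 2%:E &
    forall phi, test_function phi ->
      \int[mu]_x (derive1 phi x * f x) = - \int[mu]_x (phi x * g x)].

Lemma weak_pair_Re (f g : R -> R[i]) : H1_pair f g ->
  weak_pair (@complex.Re _ \o f) (@complex.Re _ \o g).
Proof.
move=> [[f2 _] [g2 _] fg]; split=> // phi /fg.
by rewrite !cintegralM => -[].
Qed.

Lemma weak_pair_Im (f g : R -> R[i]) : H1_pair f g ->
  weak_pair (@complex.Im _ \o f) (@complex.Im _ \o g).
Proof.
move=> [[_ f2] [_ g2] fg]; split=> // phi /fg.
by rewrite !cintegralM => -[].
Qed.

(** The indicator function of the band |x - y| < d of the plane, seen as a
    function of y for a fixed x. *)
Definition slab d x y : R := \1_(ball x d) y.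

Lemma slabE d x y : slab d x y = (`|x - y| < d)%R%:R.
Proof.
rewrite /slab indicE; congr (nat_of_bool _)%:R.
by apply/idP/idP; rewrite inE -ball_normE.
Qed.

Lemma slabC d x y : slab d x y = slab d y x.
Proof. by rewrite !slabE distrC. Qed.

Lemma slab_ge0 d x y : 0 <= slab d x y.
Proof. by rewrite slabE. Qed.

Lemma slab_Lfun2 d x : slab d x \in Lfun mu 2%:E.
Proof.
apply: Lfun2_indic; first exact: measurable_ball.
have [d0|d0] := leP 0 d; first by rewrite lebesgue_measure_ball// ltry.
by rewrite (ball0 _ _).2 ?measure0// ltW.
Qed.

(** The mollifier of width e, supported between -3 e and 3 e, and its derivative. *)
Definition mollifier e z : R := e^-1 * spline_bump (e^-1 * z).
Definition dmollifier e z : R := e^-1 ^+ 2 * spline_dbump (e^-1 * z).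

Lemma is_derive_scale e x y : is_derive y 1 (fun y => e^-1 * (y - x)) e^-1.
Proof. by apply: is_derive_eq; rewrite subr0 /GRing.scale/= mulr1. Qed.

Lemma is_derive_step e x y :
  is_derive y 1 (fun y => spline_step (e^-1 * (y - x))) (mollifier e (y - x)).
Proof.
rewrite /mollifier mulrC; have ? := is_derive_scale e x y.
exact: (@is_derive1_comp _ spline_step (fun y => e^-1 * (y - x))).
Qed.

Lemma is_derive_mollifier e x y :
  is_derive y 1 (fun y => mollifier e (y - x)) (dmollifier e (y - x)).
Proof.
have ? := is_derive_scale e x y.
rewrite /mollifier /dmollifier expr2 -mulrA [X in _ * X]mulrC.
have ? := (@is_derive1_comp _ spline_bump (fun y => e^-1 * (y - x))).
exact: (@is_deriveZ _ _ _ (spline_bump \o (fun y => e^-1 * (y - x))) e^-1).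
Qed.

Lemma continuous_scale e : continuous (fun z : R => e^-1 * z).
Proof. by move=> z; exact: mulrl_continuous. Qed.

Lemma continuous_mollifier e : continuous (mollifier e).
Proof.
move=> z; apply: cvgM; first exact: cst_continuous.
apply: (@continuous_comp _ _ _ (fun z : R => e^-1 * z) spline_bump).
  exact: continuous_scale.
exact: continuous_spline_bump.
Qed.

Lemma continuous_dmollifier e : continuous (dmollifier e).
Proof.
move=> z; apply: cvgM; first exact: cst_continuous.
apply: (@continuous_comp _ _ _ (fun z : R => e^-1 * z) spline_dbump).
  exact: continuous_scale.
exact: continuous_spline_dbump.
Qed.

Lemma continuous_sub x : continuous (fun y : R => y - x).
Proof. by move=> y; apply: cvgB; [exact: cvg_id|exact: cst_continuous]. Qed.

Lemma ler3V e z : 0 < e -> (3 <= `|e^-1 * z|) = (3 * e <= `|z|).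
Proof. by move=> e0; rewrite normrM gtr0_norm ?invr_gt0// mulrC ler_pdivlMr. Qed.

Lemma mollifier0 e z : 0 < e -> 3 * e <= `|z| -> mollifier e z = 0.
Proof. by move=> e0; rewrite -ler3V// /mollifier => /spline_bump0 ->; rewrite mulr0. Qed.

Lemma dmollifier0 e z : 0 < e -> 3 * e <= `|z| -> dmollifier e z = 0.
Proof. by move=> e0; rewrite -ler3V// /dmollifier => /spline_dbump0 ->; rewrite mulr0. Qed.

Lemma mollifierN e z : mollifier e (- z) = mollifier e z.
Proof. by rewrite /mollifier mulrN spline_bumpN. Qed.

Lemma mollifier_ge0 e z : 0 < e -> 0 <= mollifier e z.
Proof.
move=> e0; rewrite /mollifier mulr_ge0 ?invr_ge0 ?(ltW e0)//.
by case/andP: (spline_bump_itv (e^-1 * z)).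
Qed.

Lemma mollifier_norm e z : 0 < e -> `|mollifier e z| <= e^-1.
Proof.
move=> e0; rewrite ger0_norm ?mollifier_ge0// /mollifier ger_pMr ?invr_gt0//.
by case/andP: (spline_bump_itv (e^-1 * z)).
Qed.

Lemma dmollifier_norm e z : `|dmollifier e z| <= e^-1 ^+ 2.
Proof.
rewrite /dmollifier normrM ger0_norm ?sqr_ge0// ler_piMr ?sqr_ge0//.
exact: spline_dbump_norm.
Qed.

Lemma test_function_mollifier e x : 0 < e ->
  test_function (fun y => mollifier e (y - x)).
Proof.
move=> e0; split.
- by move=> y; have [] := is_derive_mollifier e x y.
- have -> : derive1 (fun y => mollifier e (y - x)) = fun y => dmollifier e (y - x).
    by apply/funext => y; rewrite derive1E; have [_ ->] := is_derive_mollifier e x y.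
  move=> y; apply: (@continuous_comp _ _ _ (fun y => y - x) (dmollifier e)).
    exact: continuous_sub.
  exact: continuous_dmollifier.
- exists (`|x| + 3 * e) => y ly; apply: mollifier0 => //.
  by have := lerB_normD y (- x); rewrite normrN; lra.
Qed.

(** The difference of two smoothed steps centred at x. It is a test function of
    y, and its derivative is the difference of the mollifiers of widths e and
    r. *)
Definition step_diff e r x y :=
  spline_step (e^-1 * (y - x)) - spline_step (r^-1 * (y - x)).

Lemma is_derive_step_diff e r x y :
  is_derive y 1 (step_diff e r x) (mollifier e (y - x) - mollifier r (y - x)).
Proof.
have ? := is_derive_step e x y; have ? := is_derive_step r x y.
exact: (@is_deriveB _ _ _ (fun y => spline_step (e^-1 * (y - x)))
  (fun y => spline_step (r^-1 * (y - x)))).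
Qed.

Lemma step_scale e z : 0 < e -> 3 * e <= `|z| ->
  spline_step (e^-1 * z) = (0 <= z)%R%:R.
Proof.
move=> e0; rewrite -ler3V// => h; have [z0|z0] := leP 0 z.
  rewrite spline_stepr//; move: h; rewrite ger0_norm// mulr_ge0// invr_ge0 ltW//.
rewrite spline_stepl//; move: h; rewrite ler0_norm; first lra.
by rewrite mulr_ge0_le0// ?invr_ge0 ltW.
Qed.

Lemma step_diff0 e r x y : 0 < r -> r <= e -> 3 * e <= `|x - y| ->
  step_diff e r x y = 0.
Proof.
move=> r0 re; rewrite distrC => h; have e0 := lt_le_trans r0 re.
have h' : 3 * r <= `|y - x| by rewrite (le_trans _ h)// ler_pM2l.
by rewrite /step_diff !step_scale// subrr.
Qed.

Lemma step_diff_slab e r x y : 0 < r -> r <= e ->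
  `|step_diff e r x y| <= slab (3 * e) x y.
Proof.
move=> r0 re; rewrite slabE; case: ltP => h.
  have := spline_step_itv (e^-1 * (y - x)); have := spline_step_itv (r^-1 * (y - x)).
  by rewrite /step_diff => /andP[? ?] /andP[? ?]; rewrite ler_norml /=; lra.
by rewrite step_diff0// normr0.
Qed.

Lemma test_function_step_diff e r x : 0 < r -> r <= e ->
  test_function (step_diff e r x).
Proof.
move=> r0 re; split.
- by move=> y; have [] := is_derive_step_diff e r x y.
- have -> : derive1 (step_diff e r x) =
      fun y => mollifier e (y - x) - mollifier r (y - x).
    by apply/funext => y; rewrite derive1E; have [_ ->] := is_derive_step_diff e r x y.
  have c a : continuous (fun y => mollifier a (y - x)).
    move=> y; apply: (@continuous_comp _ _ _ (fun y => y - x) (mollifier a)).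
      exact: continuous_sub.
    exact: continuous_mollifier.
  by move=> y; apply: cvgB; exact: c.
- exists (`|x| + 3 * e) => y ly; apply: step_diff0 => //.
  by have := lerB_normD y (- x); rewrite normrN distrC; lra.
Qed.

Lemma mollifier_slab e x y : 0 < e ->
  `|mollifier e (y - x)| <= e^-1 * slab (3 * e) x y.
Proof.
move=> e0; rewrite slabE distrC; case: ltP => h.
  by rewrite mulr1 mollifier_norm.
by rewrite mulr0 mollifier0// normr0.
Qed.

Lemma mollifier_Lfun2 e x : 0 < e -> (fun y => mollifier e (y - x)) \in Lfun mu 2%:E.
Proof.
by move=> e0; have [] := test_function_Lfun2 (test_function_mollifier x e0).
Qed.

(** The convolution of f with the even mollifier of width e. *)
Definition mollify e f x : R := \int[mu]_y (mollifier e (y - x) * f y).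

Lemma integral_mollifier e x : 0 < e -> \int[mu]_y mollifier e (y - x) = 1.
Proof.
move=> e0.
have dS y : is_derive y 1 (fun y => spline_step (e^-1 * (y - x))) (mollifier e (y - x)).
  exact: is_derive_step.
have -> : \int[mu]_y mollifier e (y - x) =
    \int[mu]_(y in `[x - 3 * e, x + 3 * e]) mollifier e (y - x).
  rewrite [RHS]Rintegral_mkcond; apply: eq_Rintegral => y _.
  rewrite patchE; case: ifPn => //.
  rewrite notin_setE /= in_itv /= => /negP h.
  apply: mollifier0 => //; rewrite leNgt; apply: contra h.
  by rewrite ltr_norml => /andP[]; lra.
rewrite /Rintegral (@continuous_FTC2 _ (fun y => mollifier e (y - x))
  (fun y => spline_step (e^-1 * (y - x)))).
- have -> : x + 3 * e - x = 3 * e by ring.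
  have -> : x - 3 * e - x = - (3 * e) by ring.
  rewrite /= spline_stepr ?spline_stepl ?subr0//.
  + by rewrite mulrN mulrCA mulVf ?mulr1// gt_eqF.
  + by rewrite mulrCA mulVf ?mulr1// gt_eqF.
- lra.
- apply: continuous_subspaceT => y.
  apply: (@continuous_comp _ _ _ (fun y => y - x) (mollifier e)).
    exact: continuous_sub.
  exact: continuous_mollifier.
- have cS : continuous (fun y => spline_step (e^-1 * (y - x))).
    by move=> y; apply/differentiable_continuous/derivable1_diffP; have [] := dS y.
  split=> [y _||].
  + by have [] := dS y.
  + by apply: cvg_at_right_filter; exact: cS.
  + by apply: cvg_at_left_filter; exact: cS.
- by move=> y _; rewrite derive1E; have [_ ->] := dS y.
Qed.

End mollifier.

(** * Approximation of a weakly differentiable function by its mollifications *)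

Section weak_derivative.
Context {R : realType}.
Local Notation mu := (@lebesgue_measure R).
Implicit Types (f g h : R -> R) (d e r x y z : R).

Lemma Lfun2_locally_integrable f : f \in Lfun mu 2%:E -> locally_integrable setT f.
Proof.
move=> f2; have mf := Lfun2_measurable f2; split => //; first exact: openT.
move=> K _ cK; have mK := compact_measurable cK.
have Koo := compact_finite_measure cK.
have /integrableP[_] := intble_abs (intbleM (Lfun2_indic mK Koo) f2).
apply: le_lt_trans; rewrite integral_mkcond.
rewrite le_eqVlt; apply/orP; left; apply/eqP; apply: eq_integral => x _.
rewrite patchE /= indicE; case: ifPn => _; first by rewrite mul1r normr_id.
by rewrite mul0r !normr0.
Qed.

Lemma slab_intble d x f : f \in Lfun mu 2%:E ->
  intble (fun y => slab d x y * `|f y|).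
Proof. by move=> f2; apply: intbleM; [exact: slab_Lfun2|exact: Lfun2_abs]. Qed.

Lemma slab_cst_intble d x c : intble (fun y => slab d x y * c).
Proof.
have := intbleZ c (intble_sqr (slab_Lfun2 d x)).
rewrite (_ : (fun y => c * _) = (fun y => slab d x y * c))//.
apply/funext => y; by rewrite slabE mulrC; case: ltP => _; rewrite ?expr1n ?expr0n.
Qed.

Lemma mollify_intble e f x : 0 < e -> f \in Lfun mu 2%:E ->
  intble (fun y => mollifier e (y - x) * f y).
Proof. by move=> e0 f2; apply: intbleM => //; exact: mollifier_Lfun2. Qed.

(** The mollified value is compared with the mean oscillation of f on the ball of
    radius 3 r, which tends to 0 at a Lebesgue point. *)
Lemma mollify_davg f x r : f \in Lfun mu 2%:E -> 0 < r ->
  ((`|mollify r f x - f x|)%:E <= 6%:E * davg f x (3 * r))%E.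
Proof.
move=> f2 r0.
have mf := Lfun2_measurable f2.
have ib : intble (fun y => slab (3 * r) x y * `|f y - f x|).
  apply: (@intble_le _ _ (fun y => slab (3 * r) x y * `|f y| + slab (3 * r) x y * `|f x|)).
  - apply: measurable_funM; first exact: Lfun2_measurable (slab_Lfun2 _ _).
    apply: measurableT_comp => //. by apply: measurable_funB.
  - by apply: intbleD; [exact: slab_intble|exact: slab_cst_intble].
  - move=> y; rewrite normrM normr_id ger0_norm ?slab_ge0// -mulrDr ler_wpM2l ?slab_ge0//.
    exact: ler_normB.
have -> : davg f x (3 * r) = ((6 * r)^-1 *
    \int[mu]_y (slab (3 * r) x y * `|f y - f x|))%:E.
  rewrite /davg /iavg lebesgue_measure_ball; last by rewrite mulr_ge0 ?ltW.
  rewrite EFinM (_ : (3 * r) *+ 2 = 6 * r); last by ring.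
  have r6 : 6 * r != 0 by rewrite mulf_neq0 ?gt_eqF.
  rewrite inver (negbTE r6); congr (_ * _)%E.
  rewrite integral_mkcond /Rintegral fineK; last exact: integrable_fin_num ib.
  apply: eq_integral => y _; rewrite patchE /slab indicE /=.
  by case: ifPn => _; rewrite ?mul1r ?mul0r.
rewrite -EFinM lee_fin.
have -> : mollify r f x - f x = \int[mu]_y (mollifier r (y - x) * (f y - f x)).
  under eq_Rintegral do rewrite mulrBr.
  rewrite RintegralB//; last first.
  - have := intbleZ (f x) (mollify_intble x r0 (slab_Lfun2 (3 * r) x)).
    rewrite (_ : (fun y => _ * _) = (fun y => mollifier r (y - x) * f x))//.
    apply/funext => y; rewrite slabE mulrC; congr (_ * _).
    case: ltP => h; first by rewrite mulr1.
    by rewrite mulr0 mollifier0// distrC.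
  - exact: mollify_intble.
  congr (_ - _); under eq_Rintegral do rewrite mulrC.
  rewrite RintegralZl//; first by rewrite integral_mollifier// mulr1.
  have := (mollify_intble x r0 (slab_Lfun2 (3 * r) x)).
  rewrite (_ : (fun y => _ * _) = (fun y => mollifier r (y - x)))//.
  apply/funext => y; rewrite slabE; case: ltP => h; first by rewrite mulr1.
  by rewrite mulr0 mollifier0// distrC.
have -> : 6 * ((6 * r)^-1 * \int[mu]_y (slab (3 * r) x y * `|f y - f x|)) =
   \int[mu]_y (r^-1 * (slab (3 * r) x y * `|f y - f x|)).
  by rewrite RintegralZl//; field; rewrite gt_eqF.
apply: norm_Rintegral_ae.
- apply: measurable_funM; last exact: measurable_funB.
  by have := Lfun2_measurable (mollifier_Lfun2 x r0).
- exact: intbleZ.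
- apply/nearW => y; rewrite normrM mulrA ler_wpM2r//.
  exact: mollifier_slab.
Qed.

(** The difference of two mollifications is tested against [step_diff], so only
    the weak derivative of f enters. *)
Lemma mollifyB_le e r f g x : weak_pair f g -> 0 < r -> r <= e ->
  `|mollify e f x - mollify r f x| <= \int[mu]_y (slab (3 * e) x y * `|g y|).
Proof.
move=> [f2 g2 fg] r0 re; have e0 := lt_le_trans r0 re.
have tphi := test_function_step_diff x r0 re.
have := fg _ tphi.
have -> : \int[mu]_y (derive1 (step_diff e r x) y * f y) =
    mollify e f x - mollify r f x.
  rewrite -RintegralB//; [|exact: mollify_intble..].
  apply: eq_Rintegral => y _; rewrite derive1E.
  by have [_ ->] := is_derive_step_diff e r x y; rewrite mulrBl.
move=> ->; rewrite normrN; apply: norm_Rintegral_ae.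
- apply: measurable_funM; last exact: Lfun2_measurable.
  by have [/Lfun2_measurable] := test_function_Lfun2 tphi.
- exact: slab_intble.
- by apply/nearW => y; rewrite normrM ler_wpM2r// step_diff_slab.
Qed.

(** The quantitative form of mollification on which both integration by parts and
    the Sobolev embedding rest; it follows from the two preceding lemmas as r tends
    to 0 at a Lebesgue point x. *)
Lemma mollify_approx e f g : weak_pair f g -> 0 < e ->
  {ae mu, forall x, `|mollify e f x - f x| <=
                     \int[mu]_y (slab (3 * e) x y * `|g y|)}.
Proof.
move=> fg e0; have [f2 g2 _] := fg.
have := lebesgue_differentiation (Lfun2_locally_integrable f2).
apply: aeS => x fx; apply/ler_addgt0Pr => eps eps0.
have fx' : (davg f x r @[r --> 0^'+] --> 0)%E by [].
have fx6 : \forall r \near 0^'+, (davg f x r < (eps / 6)%:E)%E.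
  apply: (fx' [set y | (y < (eps / 6)%:E)%E]); apply: open_nbhs_nbhs; split.
    exact: open_ereal_lt_ereal.
  by rewrite /= lte_fin divr_gt0.
have [r [r0 re dr]] : exists r, [/\ 0 < r, r <= 3 * e & (davg f x r < (eps / 6)%:E)%E].
  have e3 : 0 < 3 * e by rewrite mulr_gt0.
  near (0 : R)^'+ => r; exists r; split; near: r => //.
  - exact: nbhs_right_gt.
  - exact: nbhs_right_le.
have r3 : 0 < r / 3 by rewrite divr_gt0.
have r3e : r / 3 <= e by lra.
rewrite (_ : mollify e f x - f x = (mollify e f x - mollify (r / 3) f x) +
    (mollify (r / 3) f x - f x)); last by ring.
apply: le_trans (ler_normD _ _) _; apply: lerD.
  exact: mollifyB_le fg r3 r3e.
have := mollify_davg x f2 r3.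
rewrite (_ : 3 * (r / 3) = r); last by field.
move=> h; rewrite -lee_fin; apply: le_trans h _.
rewrite (_ : eps%:E = 6%:E * (eps / 6)%:E)%E; last by rewrite -EFinM; congr EFin; field.
by rewrite lee_pmul2l// ?lte_fin// ltW.
Unshelve. all: by end_near. Qed.

End weak_derivative.

(** * Integration by parts and the Sobolev bound *)

Section integration_by_parts.
Context {R : realType}.
Local Notation mu := (@lebesgue_measure R).
Implicit Types (f g h u w k : R -> R) (d e r x y : R).

Lemma integral_slab d x c : 0 <= d -> 0 <= c ->
  (\int[mu]_y (slab d x y * c)%:E = (2 * d * c)%:E)%E.
Proof.
move=> d0 c0; under eq_integral do rewrite mulrC EFinM.
rewrite ge0_integralZl//; last 2 first.
- by apply/measurable_EFinP; exact: (Lfun2_measurable (slab_Lfun2 d x)).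
- by move=> y _; rewrite lee_fin slab_ge0.
rewrite /slab integral_indic//; last exact: measurable_ball.
rewrite setIT; transitivity (c%:E * (d *+ 2)%:E)%E.
  by congr (_ * _)%E; exact: lebesgue_measure_ball.
by rewrite -EFinM; congr EFin; ring.
Qed.

Lemma measurable_slab d : measurable_fun [set: R * R] (fun z => slab d z.1 z.2).
Proof.
have -> : (fun z : R * R => slab d z.1 z.2) =
    (\1_(`]-oo, d[ : set R) : R -> R) \o (fun z => `|z.1 - z.2|).
  by apply/funext => z /=; rewrite slabE indicE mem_setE in_itv.
apply: measurableT_comp; first exact: measurable_indic.
apply: measurableT_comp => //.
by apply: measurable_funB; [exact: measurable_fst|exact: measurable_snd].
Qed.

Let slabprod d u w (z : R * R) := (slab d z.1 z.2 * `|u z.1| * `|w z.2|)%:E.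

Lemma measurable_fst_comp u : measurable_fun setT u ->
  measurable_fun [set: R * R] (fun z => u z.1).
Proof. by move=> mu_; apply: measurableT_comp => //; exact: measurable_fst. Qed.

Lemma measurable_snd_comp u : measurable_fun setT u ->
  measurable_fun [set: R * R] (fun z => u z.2).
Proof. by move=> mu_; apply: measurableT_comp => //; exact: measurable_snd. Qed.

Let measurable_slabprod d u w : u \in Lfun mu 2%:E -> w \in Lfun mu 2%:E ->
  measurable_fun [set: R * R] (slabprod d u w).
Proof.
move=> u2 w2; apply/measurable_EFinP; apply: measurable_funM.
  apply: measurable_funM; first exact: measurable_slab.
  by apply: measurableT_comp => //; apply: measurable_fst_comp; exact: Lfun2_measurable.
by apply: measurableT_comp => //; apply: measurable_snd_comp; exact: Lfun2_measurable.
Qed.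

(** By |u(x)| |w(y)| <= (u(x)^2 + w(y)^2) / 2 and the Tonelli theorem, since each
    section of the band has measure 2 d. *)
Lemma slab_product_le d u w : 0 <= d -> u \in Lfun mu 2%:E -> w \in Lfun mu 2%:E ->
  (\int[mu \x mu]_z slabprod d u w z <=
    (d * (\int[mu]_x (u x ^+ 2) + \int[mu]_x (w x ^+ 2)))%:E)%E.
Proof.
move=> d0 u2 w2.
have sq v : v \in Lfun mu 2%:E -> (\int[mu]_x (d * v x ^+ 2)%:E =
    (d * \int[mu]_x (v x ^+ 2))%:E)%E.
  move=> v2; rewrite -RintegralZl//; last exact: intble_sqr.
  rewrite /Rintegral fineK//; apply: integrable_fin_num => //.
  exact: (intbleZ d (intble_sqr v2)).
pose F1 (z : R * R) := (slab d z.1 z.2 * (2^-1 * u z.1 ^+ 2))%:E.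
pose F2 (z : R * R) := (slab d z.1 z.2 * (2^-1 * w z.2 ^+ 2))%:E.
have mF1 : measurable_fun setT F1.
  apply/measurable_EFinP; apply: measurable_funM; first exact: measurable_slab.
  apply: measurable_funM => //; apply: measurable_funX.
  by apply: measurable_fst_comp; exact: Lfun2_measurable.
have mF2 : measurable_fun setT F2.
  apply/measurable_EFinP; apply: measurable_funM; first exact: measurable_slab.
  apply: measurable_funM => //; apply: measurable_funX.
  by apply: measurable_snd_comp; exact: Lfun2_measurable.
have c0 (a : R) : 0 <= 2^-1 * a ^+ 2 by rewrite mulr_ge0 ?sqr_ge0 ?invr_ge0.
have F10 z : (0 <= F1 z)%E.
  by rewrite lee_fin mulr_ge0 ?slab_ge0.
have F20 z : (0 <= F2 z)%E.
  by rewrite lee_fin mulr_ge0 ?slab_ge0.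
apply: (@le_trans _ _ (\int[mu \x mu]_z (F1 z + F2 z))%E).
  apply: ge0_le_integral => //.
  - by move=> z _; rewrite lee_fin !mulr_ge0 ?slab_ge0.
  - exact: measurable_slabprod.
  - exact: emeasurable_funD.
  - move=> z _; rewrite -EFinD lee_fin -mulrDr -mulrA ler_wpM2l ?slab_ge0//.
    rewrite -(real_normK (num_real (u z.1))) -(real_normK (num_real (w z.2))).
    by have := sqr_ge0 (`|u z.1| - `|w z.2|); nra.
rewrite ge0_integralD//.
have E1 : (\int[mu]_x \int[mu]_y F1 (x, y) = (d * \int[mu]_x (u x ^+ 2))%:E)%E.
  rewrite -sq//; apply: eq_integral => x _; rewrite /F1 /=.
  rewrite integral_slab//.
  by congr EFin; field.
have E2 : (\int[mu]_y \int[mu]_x F2 (x, y) = (d * \int[mu]_x (w x ^+ 2))%:E)%E.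
  rewrite -sq//; apply: eq_integral => y _; rewrite /F2 /=.
  transitivity (\int[mu]_x (slab d y x * (2^-1 * w y ^+ 2))%:E)%E.
    by apply: eq_integral => x1 _; rewrite slabC.
  rewrite integral_slab//.
  by congr EFin; field.
have := @fubini_tonelli1 _ _ _ _ _ mu mu F1 mF1 F10.
rewrite /fubini_F E1 => E1'.
have := @fubini_tonelli2 _ _ _ _ _ mu mu F2 mF2 F20.
rewrite /fubini_G E2 => E2'.
by rewrite mulrDr EFinD -E1' -E2'.
Qed.

Lemma slab_product_integrable d u w : 0 <= d ->
  u \in Lfun mu 2%:E -> w \in Lfun mu 2%:E ->
  (mu \x mu)%E.-integrable setT (slabprod d u w).
Proof.
move=> d0 u2 w2; apply/integrableP; split; first exact: measurable_slabprod.
under eq_integral do rewrite gee0_abs ?lee_fin ?mulr_ge0 ?slab_ge0//.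
exact: le_lt_trans (slab_product_le d0 u2 w2) (ltry _).
Qed.

(** The integral of |w| over the interval of centre x and radius d. *)
Definition slab_int d w x : R := \int[mu]_y (slab d x y * `|w y|).

Lemma slab_intE d w x : w \in Lfun mu 2%:E ->
  (\int[mu]_y (slab d x y * `|w y|)%:E = (slab_int d w x)%:E)%E.
Proof.
move=> w2; rewrite /slab_int /Rintegral fineK//; apply: integrable_fin_num => //.
exact: slab_intble.
Qed.

Let slab_fubini d u w x : u \in Lfun mu 2%:E -> w \in Lfun mu 2%:E ->
  (\int[mu]_y slabprod d u w (x, y) = (`|u x| * slab_int d w x)%:E)%E.
Proof.
move=> u2 w2; rewrite /slabprod /=.
under eq_integral do rewrite mulrAC mulrC EFinM.
rewrite ge0_integralZl//.
- by rewrite slab_intE.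
- apply/measurable_EFinP; apply: intble_measurable; exact: slab_intble.
- by move=> y _; rewrite lee_fin mulr_ge0 ?slab_ge0.
Qed.

Lemma slab_int_intble d u w : 0 <= d -> u \in Lfun mu 2%:E -> w \in Lfun mu 2%:E ->
  intble (fun x => `|u x| * slab_int d w x).
Proof.
move=> d0 u2 w2; have := integrable_fubini_F (slab_product_integrable d0 u2 w2).
apply: eq_integrable => // x _.
by rewrite /fubini_F slab_fubini.
Qed.

Lemma slab_int_le d u w : 0 <= d -> u \in Lfun mu 2%:E -> w \in Lfun mu 2%:E ->
  \int[mu]_x (`|u x| * slab_int d w x) <=
  d * (\int[mu]_x (u x ^+ 2) + \int[mu]_x (w x ^+ 2)).
Proof.
move=> d0 u2 w2; rewrite -lee_fin.
apply: le_trans (slab_product_le d0 u2 w2).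
rewrite fubini_tonelli1//; last 2 first.
- exact: measurable_slabprod.
- by move=> z; rewrite lee_fin !mulr_ge0 ?slab_ge0.
rewrite /fubini_F; under [X in (_ <= X)%E]eq_integral do rewrite slab_fubini//.
rewrite /Rintegral fineK//; apply: integrable_fin_num => //.
exact: slab_int_intble.
Qed.

(** Fubini theorem for a convolution kernel k that is bounded and supported in a
    band. *)
Section band.
Variables (k : R -> R) (d C : R) (u w : R -> R).
Hypotheses (d0 : 0 <= d) (C0 : 0 <= C) (mk : measurable_fun setT k).
Hypothesis kd : forall x y, `|k (y - x)| <= C * slab d x y.
Hypotheses (u2 : u \in Lfun mu 2%:E) (w2 : w \in Lfun mu 2%:E).

Let F (z : R * R) := (k (z.2 - z.1) * u z.1 * w z.2)%:E.

Let integrable_F : (mu \x mu)%E.-integrable setT F.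
Proof.
have mk2 : measurable_fun [set: R * R] (fun z => k (z.2 - z.1)).
  apply: measurableT_comp => //.
  by apply: measurable_funB; [exact: measurable_snd|exact: measurable_fst].
have mF : measurable_fun setT F.
  apply/measurable_EFinP; apply: measurable_funM; last first.
    by apply: measurable_snd_comp; exact: Lfun2_measurable.
  apply: measurable_funM => //.
  by apply: measurable_fst_comp; exact: Lfun2_measurable.
have := integrableZl measurableT C (slab_product_integrable d0 u2 w2).
apply: le_integrable => //.
move=> z _; rewrite /F /= lee_fin !normrM !normr_id (ger0_norm C0).
by rewrite (ger0_norm (slab_ge0 _ _ _)) !mulrA ler_wpM2r// ler_wpM2r.
Qed.

Let band_intble1 x : intble (fun y => k (y - x) * w y).
Proof.
apply: intble_le (intbleZ C (slab_intble d x w2)) _.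
- apply: measurable_funM; last exact: Lfun2_measurable.
  by apply: measurableT_comp => //; exact: measurable_funB.
- by move=> y; rewrite normrM mulrA ler_wpM2r.
Qed.

Let band_intble2 y : intble (fun x => k (y - x) * u x).
Proof.
apply: intble_le (intbleZ C (slab_intble d y u2)) _.
- apply: measurable_funM; last exact: Lfun2_measurable.
  by apply: measurableT_comp => //; exact: measurable_funB.
- by move=> x; rewrite normrM mulrA ler_wpM2r// slabC.
Qed.

Let E1 x : (\int[mu]_y F (x, y) = (u x * \int[mu]_y (k (y - x) * w y))%:E)%E.
Proof.
rewrite -RintegralZl//; last exact: band_intble1.
rewrite /Rintegral fineK.
  by apply: eq_integral => y _; rewrite /F/=; congr EFin; ring.
by apply: integrable_fin_num => //; exact: (intbleZ (u x) (band_intble1 x)).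
Qed.

Let E2 y : (\int[mu]_x F (x, y) = (w y * \int[mu]_x (k (y - x) * u x))%:E)%E.
Proof.
rewrite -RintegralZl//; last exact: band_intble2.
rewrite /Rintegral fineK.
  by apply: eq_integral => x _; rewrite /F/=; congr EFin; ring.
by apply: integrable_fin_num => //; exact: (intbleZ (w y) (band_intble2 y)).
Qed.

Lemma intble_band : intble (fun x => u x * \int[mu]_y (k (y - x) * w y)).
Proof.
have := integrable_fubini_F integrable_F.
by apply: eq_integrable => // x _; rewrite /fubini_F E1.
Qed.

Lemma Fubini_band :
  \int[mu]_x (u x * \int[mu]_y (k (y - x) * w y)) =
  \int[mu]_y (w y * \int[mu]_x (k (y - x) * u x)).
Proof.
transitivity (fine (\int[mu]_x \int[mu]_y F (x, y))%E).
  by congr fine; apply: eq_integral => x _; rewrite E1.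
by rewrite (Fubini integrable_F); congr fine; apply: eq_integral => y _; rewrite E2.
Qed.

End band.

Lemma dmollifierN e x : dmollifier e (- x) = - dmollifier e x.
Proof.
rewrite /dmollifier mulrN; move: (e^-1 * x) => t.
suff -> : spline_dbump (- t) = - spline_dbump t by rewrite mulrN.
rewrite /spline_dbump /tpow.
rewrite (_ : - t + 3 = - (t - 3)); last by ring.
rewrite (_ : - t + 1 = - (t - 1)); last by ring.
rewrite (_ : - t - 1 = - (t + 1)); last by ring.
rewrite (_ : - t - 3 = - (t + 3)); last by ring.
have H (y : R) : Num.max 0 (- y) ^+ 1 = Num.max 0 y ^+ 1 - y.
  rewrite !expr1.
  case: (max0P y) => -[h ->]; case: (max0P (-y)) => -[h' ->]; lra.
rewrite !H; ring.
Qed.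

Lemma dmollify_l e f g x : 0 < e -> weak_pair f g ->
  \int[mu]_y (dmollifier e (y - x) * f y) = - mollify e g x.
Proof.
move=> e0 [_ _ fg]; rewrite /mollify -(fg _ (test_function_mollifier x e0)).
apply: eq_Rintegral => y _; rewrite derive1E.
by have [_ ->] := is_derive_mollifier e x y.
Qed.

Lemma dmollify_r e f g y : 0 < e -> weak_pair f g ->
  \int[mu]_x (dmollifier e (y - x) * f x) = mollify e g y.
Proof.
move=> e0 fg; rewrite -[RHS]opprK -(dmollify_l y e0 fg) -mulN1r.
rewrite -RintegralZl//.
  by apply: eq_Rintegral => x _; rewrite -opprB dmollifierN; ring.
have [f2 _ _] := fg; apply: intbleM => //.
have [_] := test_function_Lfun2 (test_function_mollifier y e0).
rewrite (_ : derive1 _ = fun x => dmollifier e (x - y))//.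
by apply/funext => x; rewrite derive1E; have [_ ->] := is_derive_mollifier e y x.
Qed.

Lemma dmollifier_slab e x y : 0 < e ->
  `|dmollifier e (y - x)| <= e^-1 ^+ 2 * slab (3 * e) x y.
Proof.
move=> e0; rewrite slabE distrC; case: ltP => h.
  by rewrite mulr1 dmollifier_norm.
by rewrite mulr0 dmollifier0// normr0.
Qed.

Lemma mollify_sym e u w : 0 < e -> u \in Lfun mu 2%:E -> w \in Lfun mu 2%:E ->
  \int[mu]_x (u x * mollify e w x) = \int[mu]_x (w x * mollify e u x).
Proof.
move=> e0 u2 w2.
have c0 : 0 <= 3 * e by rewrite mulr_ge0 ?(ltW e0).
have e10 : 0 <= e^-1 by rewrite invr_ge0 ltW.
have mk : measurable_fun setT (mollifier e).
  by apply: continuous_measurable_fun; exact: continuous_mollifier.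
rewrite /mollify.
rewrite (Fubini_band c0 e10 mk (fun x y => mollifier_slab x y e0) u2 w2).
apply: eq_Rintegral => y _; congr (_ * _); apply: eq_Rintegral => x _.
by rewrite -opprB mollifierN.
Qed.

Lemma mollify_intbleM e u w : 0 < e -> u \in Lfun mu 2%:E -> w \in Lfun mu 2%:E ->
  intble (fun x => u x * mollify e w x).
Proof.
move=> e0 u2 w2.
rewrite /mollify; apply: (@intble_band (mollifier e) (3 * e) e^-1) => //.
- by rewrite mulr_ge0 ?(ltW e0).
- by rewrite invr_ge0 ltW.
- by apply: continuous_measurable_fun; exact: continuous_mollifier.
- by move=> x y; exact: mollifier_slab.
Qed.

(** Integration by parts for mollified functions: the derivative of the mollifier
    is moved from one factor to the other by the Fubini theorem. *)
Lemma mollify_parts e f f' h h' : 0 < e -> weak_pair f f' -> weak_pair h h' ->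
  \int[mu]_x (f' x * mollify e h x) = - \int[mu]_x (h' x * mollify e f x).
Proof.
move=> e0 ff' hh'; have [f2 f'2 _] := ff'; have [h2 h'2 _] := hh'.
rewrite mollify_sym// [in RHS]mollify_sym//.
have c0 : 0 <= 3 * e by rewrite mulr_ge0 ?(ltW e0).
have mk : measurable_fun setT (dmollifier e).
  by apply: continuous_measurable_fun; exact: continuous_dmollifier.
have := Fubini_band c0 (sqr_ge0 e^-1) mk (fun x y => dmollifier_slab x y e0) f2 h2.
have -> : \int[mu]_x (f x * \int[mu]_y (dmollifier e (y - x) * h y)) =
    - \int[mu]_x (f x * mollify e h' x).
  rewrite -mulN1r -RintegralZl//; last exact: mollify_intbleM.
  by apply: eq_Rintegral => x _; rewrite (dmollify_l _ e0 hh'); ring.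
move=> ->; apply: eq_Rintegral => y _.
by rewrite (dmollify_r _ e0 ff').
Qed.

Lemma mollify_error e u h h' : 0 < e -> u \in Lfun mu 2%:E -> weak_pair h h' ->
  `|\int[mu]_x (u x * h x) - \int[mu]_x (u x * mollify e h x)| <=
  3 * e * (\int[mu]_x (u x ^+ 2) + \int[mu]_x (h' x ^+ 2)).
Proof.
move=> e0 u2 hh'; have [h2 h'2 _] := hh'.
have e3 : 0 <= 3 * e by rewrite mulr_ge0 ?(ltW e0).
rewrite -RintegralB//; [|exact: intbleM|exact: mollify_intbleM].
apply: le_trans (slab_int_le e3 u2 h'2).
apply: norm_Rintegral_ae.
- apply: intble_measurable; apply: intbleB; [exact: intbleM|exact: mollify_intbleM].
- exact: slab_int_intble.
- have := mollify_approx hh' e0; apply: aeS => x hx.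
  by rewrite -mulrBr normrM ler_wpM2l// distrC.
Qed.

(** The two sides differ from their mollified versions, which are equal, by
    O(e); then e tends to 0. *)
Lemma weak_integration_by_parts f f' h h' : weak_pair f f' -> weak_pair h h' ->
  \int[mu]_x (f' x * h x) = - \int[mu]_x (h' x * f x).
Proof.
move=> ff' hh'; have [f2 f'2 _] := ff'; have [h2 h'2 _] := hh'.
set X := \int[mu]_x (f' x * h x); set Y := \int[mu]_x (h' x * f x).
set K := \int[mu]_x (f' x ^+ 2) + \int[mu]_x (h' x ^+ 2).
have K0 : 0 <= K by rewrite addr_ge0// Rintegral_ge0// => x _; exact: sqr_ge0.
have B e : 0 < e -> `|X + Y| <= 6 * e * K.
  move=> e0.
  have h1 := mollify_error e0 f'2 hh'; have h2' := mollify_error e0 h'2 ff'.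
  move: h1 h2'; rewrite (mollify_parts e0 ff' hh') opprK.
  set Z := \int[mu]_x (h' x * mollify e f x).
  rewrite -/X -/Y [X in _ * X]addrC -/K [\int[mu]_x (h' x ^+ 2) + _]addrC -/K => h1 h3.
  rewrite (_ : X + Y = (X + Z) + (Y - Z)); last by ring.
  by apply: le_trans (ler_normD _ _) _; lra.
apply/eqP; rewrite -addr_eq0 -normr_le0; apply/ler_addgt0Pr => eps eps0.
rewrite add0r; have k1 : 0 < 6 * (K + 1) by lra.
apply: le_trans (B (eps / (6 * (K + 1))) _) _; first by rewrite divr_gt0.
rewrite (_ : 6 * _ * K = eps * (K / (K + 1))); last by field; lra.
by rewrite ger_pMr// ler_pdivrMr; lra.
Qed.

(** The L^2 norm. *)
Definition nrm2 f : R := Num.sqrt (\int[mu]_x (f x ^+ 2)).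

Lemma slab_int_nrm2 x w : w \in Lfun mu 2%:E -> slab_int 3 w x <= 3 * nrm2 w.
Proof.
move=> w2; rewrite /slab_int.
have := Cauchy_Schwarz (slab_Lfun2 3 x) (Lfun2_abs w2).
move=> /(le_trans (ler_norm _)) /le_trans; apply.
have -> : \int[mu]_y (`|w y| ^+ 2) = \int[mu]_y (w y ^+ 2).
  by apply: eq_Rintegral => y _; rewrite real_normK ?num_real.
rewrite ler_wpM2r ?sqrtr_ge0//.
have -> : \int[mu]_y (slab 3 x y ^+ 2) = 6.
  have h := @integral_slab 3 x 1 (ler0n _ _) ler01.
  transitivity (fine (2 * 3 * 1 : R)%:E); last by rewrite /=; ring.
  rewrite -h; congr fine; apply: eq_integral => y _.
  by rewrite mulr1 slabE; case: ltP => _; rewrite ?expr1n ?expr0n.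
by rewrite -[leRHS]ger0_norm// -sqrtr_sqr ler_wsqrtr//; lra.
Qed.

(** The Sobolev bound of the supremum of f by the L^2 norms of f and f'. *)
Lemma weak_pair_bound f g : weak_pair f g ->
  {ae mu, forall x, `|f x| <= 3 * (nrm2 f + nrm2 g)}.
Proof.
move=> fg; have [f2 g2 _] := fg.
have := mollify_approx fg ltr01; apply: aeS => x.
rewrite mulr1 => h.
have h1 := slab_int_nrm2 x g2; have h2 := slab_int_nrm2 x f2.
have h3 : `|mollify 1 f x| <= slab_int 3 f x.
  rewrite /mollify; apply: norm_Rintegral_ae.
  - by apply: intble_measurable; exact: mollify_intble.
  - exact: slab_intble.
  - apply/nearW => y; rewrite normrM ler_wpM2r//.
    by have := @mollifier_slab _ 1 x y ltr01; rewrite invr1 mul1r mulr1.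
rewrite /slab_int in h1; have := lerB_normD (f x) (- mollify 1 f x).
rewrite normrN distrC => h4; lra.
Qed.

End integration_by_parts.

(** * The power nonlinearity *)

Section power.
Context {R : realType}.
Implicit Types (p q x y a b c M : R).

(** The graph of the q-th power lies above its tangents. *)
Lemma powR_tangent q x y : 1 <= q -> 0 <= x -> 0 <= y ->
  y `^ q - x `^ q <= q * y `^ (q - 1) * (y - x).
Proof.
move=> q1 x0 y0; have q0 : 0 < q by lra.
have [->|yn0] := eqVneq y 0.
  rewrite powR0 ?gt_eqF// !sub0r.
  have [->|qn1] := eqVneq q 1; first by rewrite subrr powRr0 powRr1//; lra.
  by rewrite powR0 ?subr_eq0// mulr0 mul0r oppr_le0 powR_ge0.
have y1 : 0 < y by rewrite lt_def yn0.
have [->|xn0] := eqVneq x 0.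
  rewrite powR0 ?gt_eqF// !subr0 -(mulr_powRB1 y0 q0) mulrAC -mulrA ler_peMl//.
  by rewrite mulr_ge0 ?powR_ge0.
have x1 : 0 < x by rewrite lt_def xn0.
have mv a b : 0 < a -> a < b ->
    exists2 c, c \in `]a, b[%R & b `^ q - a `^ q = q * c `^ (q - 1) * (b - a).
  move=> a0 ab; apply: (@MVT _ (fun t => t `^ q) (fun t => q * t `^ (q - 1))) => //.
    move=> t; rewrite in_itv/= => /andP[at_ _].
    exact/is_derive1_powR/(lt_trans a0).
  apply: continuous_in_subspaceT => t; rewrite inE/= in_itv/= => /andP[at_ _].
  apply/differentiable_continuous/derivable1_diffP.
  by have [] := is_derive1_powR q (lt_le_trans a0 at_).
have mono c d : 0 < c -> c <= d -> c `^ (q - 1) <= d `^ (q - 1).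
  by move=> c0 cd; rewrite ge0_ler_powR ?nnegrE//; lra.
have [xy|yx|->] := ltgtP x y; last by rewrite !subrr mulr0.
- have [c /[!in_itv]/= /andP[xc cy] ->] := mv _ _ x1 xy.
  rewrite ler_wpM2r ?subr_ge0 ?(ltW xy)// ler_wpM2l ?(ltW q0)//.
  by apply: mono; [exact: lt_trans xc|exact: ltW].
- have [c /[!in_itv]/= /andP[yc cx] h] := mv _ _ y1 yx.
  rewrite -opprB h -[y - x]opprB mulrN lerN2.
  rewrite ler_wpM2r ?subr_ge0 ?(ltW yx)// ler_wpM2l ?(ltW q0)//.
  by apply: mono => //; exact: ltW.
Qed.

Lemma ler_powRl s a b : 0 <= s -> 0 <= a -> a <= b -> a `^ s <= b `^ s.
Proof.
by move=> s0 a0 ab; rewrite ge0_ler_powR ?nnegrE// (le_trans a0).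
Qed.

Lemma powR_lip q M a b : 1 <= q -> 0 <= a <= M -> 0 <= b <= M ->
  `|a `^ q - b `^ q| <= q * M `^ (q - 1) * `|a - b|.
Proof.
move=> q1; wlog ba : a b / b <= a => [H|].
  move=> aM bM; have [ab|/ltW ba] := leP a b.
    by rewrite distrC [`|a - b|]distrC; exact: H.
  exact: H.
move=> /andP[a0 aM] /andP[b0 bM].
rewrite !ger0_norm ?subr_ge0//; last first.
  by apply: ler_powRl => //; lra.
apply: le_trans (powR_tangent q1 b0 a0) _.
rewrite ler_wpM2r ?subr_ge0// ler_wpM2l//; first lra.
by apply: ler_powRl => //; lra.
Qed.

(** The power p - 1 need not be Lipschitz near 0 (it is only Hoelder continuous
    when p < 2); the factor c restores the Lipschitz bound. *)
Lemma powR_diff_mul p M a c : 1 <= p -> 0 <= a <= M -> 0 <= c <= M ->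
  `|a `^ (p - 1) - c `^ (p - 1)| * c <= (p + 1) * M `^ (p - 1) * `|a - c|.
Proof.
move=> p1 aM cM; have /andP[a0 aM'] := aM; have /andP[c0 cM'] := cM.
have p0 : 0 < p by lra.
have -> : `|a `^ (p - 1) - c `^ (p - 1)| * c =
    `|(a `^ p - c `^ p) - a `^ (p - 1) * (a - c)|.
  rewrite -[X in _ * X](ger0_norm c0) -normrM -(mulr_powRB1 a0 p0) -(mulr_powRB1 c0 p0).
  by congr `|_|; ring.
apply: le_trans (ler_normB _ _) _.
have := powR_lip p1 aM cM.
rewrite normrM (ger0_norm (powR_ge0 _ _)).
have : a `^ (p - 1) * `|a - c| <= M `^ (p - 1) * `|a - c|.
  by rewrite ler_wpM2r// ler_powRl//; lra.
lra.
Qed.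

Lemma powR_sqr a p : 0 <= a -> (a ^+ 2) `^ ((p + 1) / 2) = a `^ (p + 1).
Proof.
by move=> a0; rewrite -powR_mulrn// -powRrM; congr (_ `^ _); field.
Qed.

Lemma powR_sqrB a p : 0 <= a -> (a ^+ 2) `^ ((p + 1) / 2 - 1) = a `^ (p - 1).
Proof.
by move=> a0; rewrite -powR_mulrn// -powRrM; congr (_ `^ _); field.
Qed.

Lemma potential_side p M a b c t : 1 <= p ->
  0 <= a -> 0 <= b -> 0 <= c <= M -> 0 <= t <= M ->
  `|2^-1 * (t `^ (p - 1) - c `^ (p - 1)) * (a ^+ 2 - b ^+ 2)| <=
  ((p + 1) * `|t - c| + 2^-1 * (`|a - c| + `|b - c|)) * M `^ (p - 1) * `|a - b|.
Proof.
move=> p1 a0 b0 cM tM; have h1 := powR_diff_mul p1 tM cM.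
have /andP[c0 cM'] := cM; have /andP[t0 tM'] := tM.
have h2 : `|t `^ (p - 1) - c `^ (p - 1)| <= M `^ (p - 1).
  have ht : t `^ (p - 1) <= M `^ (p - 1) by apply: ler_powRl => //; lra.
  have hc : c `^ (p - 1) <= M `^ (p - 1) by apply: ler_powRl => //; lra.
  have := powR_ge0 t (p - 1); have := powR_ge0 c (p - 1).
  move: ht hc; move: (t `^ _) (c `^ _) (M `^ _) => T C L *.
  by rewrite ler_norml; apply/andP; split; lra.
move: h1 h2; set L := M `^ (p - 1); set d := t `^ (p - 1) - c `^ (p - 1).
have D0 := normr_ge0 d.
have -> : `|2^-1 * d * (a ^+ 2 - b ^+ 2)| = 2^-1 * `|d| * (a + b) * `|a - b|.
  rewrite subr_sqr !normrM (ger0_norm (addr_ge0 a0 b0)).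
  by rewrite (@ger0_norm _ 2^-1) ?invr_ge0//; ring.
move: `|d| D0 => D D0 h1 h2; rewrite ler_wpM2r//.
have ha : D * a <= D * c + L * `|a - c|.
  have h : a <= c + `|a - c| by have := ler_norm (a - c); lra.
  apply: le_trans (ler_wpM2l D0 h) _; rewrite mulrDr lerD2l.
  exact: ler_wpM2r.
have hb : D * b <= D * c + L * `|b - c|.
  have h : b <= c + `|b - c| by have := ler_norm (b - c); lra.
  apply: le_trans (ler_wpM2l D0 h) _; rewrite mulrDr lerD2l.
  exact: ler_wpM2r.
clear -h1 ha hb.
rewrite -mulrA mulrDr.
apply: (@le_trans _ _ (2^-1 * ((D * c + L * `|a - c|) + (D * c + L * `|b - c|)))).
  by rewrite ler_wpM2l ?invr_ge0// lerD.
move: h1; move: (D * c) => X; lra.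
Qed.

(** The potential (p+1)^-1 a^(p+1) is the convex function t^((p+1)/2) of t = a^2;
    the tangents of the latter at a^2 and b^2 enclose the left-hand side. *)
Lemma potential_modulus p M a b c : 1 <= p ->
  0 <= a <= M -> 0 <= b <= M -> 0 <= c <= M ->
  `|(p + 1)^-1 * (a `^ (p + 1) - b `^ (p + 1)) -
     2^-1 * c `^ (p - 1) * (a ^+ 2 - b ^+ 2)| <=
  (p + 2) * M `^ (p - 1) * (`|a - c| + `|b - c|) * `|a - b|.
Proof.
move=> p1 aM bM cM; have /andP[a0 aM'] := aM; have /andP[b0 bM'] := bM.
have p0 : 0 < p + 1 by lra.
have q1 : 1 <= (p + 1) / 2 by lra.
have T1 := powR_tangent q1 (sqr_ge0 b) (sqr_ge0 a).
have T2 := powR_tangent q1 (sqr_ge0 a) (sqr_ge0 b).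
rewrite !powR_sqr// powR_sqrB// in T1.
rewrite !powR_sqr// powR_sqrB// in T2.
have sa := potential_side p1 a0 b0 cM aM; have sb := potential_side p1 a0 b0 cM bM.
have L0 := powR_ge0 M (p - 1).
move: T1 T2 sa sb L0.
move: (a `^ (p + 1)) (b `^ (p + 1)) (a `^ (p - 1)) (b `^ (p - 1)) (c `^ (p - 1))
  (M `^ (p - 1)) => X Y A B C L T1 T2 sa sb L0.
have bnd t : `|t - c| <= `|a - c| + `|b - c| ->
    ((p + 1) * `|t - c| + 2^-1 * (`|a - c| + `|b - c|)) * L * `|a - b| <=
    (p + 2) * L * (`|a - c| + `|b - c|) * `|a - b|.
  move=> h; rewrite ler_wpM2r// [leLHS]mulrC [_ * L]mulrC -mulrA ler_wpM2l//.
  have : (p + 1) * `|t - c| <= (p + 1) * (`|a - c| + `|b - c|) by rewrite ler_wpM2l// ltW.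
  have : 0 <= `|a - c| + `|b - c| by rewrite addr_ge0.
  move: (`|a - c| + `|b - c|) => s; clear; lra.
have {}sa := le_trans sa (bnd a (ler_wpDr (normr_ge0 _) (lexx _))).
have {}sb := le_trans sb (bnd b (ler_wpDl (normr_ge0 _) (lexx _))).
move: sa sb; set K := (p + 2) * _ * _ * _.
have pi : (p + 1)^-1 * (p + 1) = 1 by rewrite mulVf// gt_eqF.
have up : (p + 1)^-1 * (X - Y) <= 2^-1 * A * (a ^+ 2 - b ^+ 2).
  by rewrite mulrC ler_pdivrMr//; apply: le_trans T1 _; rewrite le_eqVlt; apply/orP;
    left; apply/eqP; field.
have dn : 2^-1 * B * (a ^+ 2 - b ^+ 2) <= (p + 1)^-1 * (X - Y).
  rewrite [leRHS]mulrC ler_pdivlMr//; rewrite -lerN2 opprB; apply: le_trans T2 _.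
  by rewrite le_eqVlt; apply/orP; left; apply/eqP; field.
move: up dn; move: ((p + 1)^-1 * (X - Y)) (a ^+ 2 - b ^+ 2) => S T.
rewrite !ler_norml => up dn /andP[sa1 sa2] /andP[sb1 sb2]; clear -up dn sa2 sb1.
by apply/andP; split; lra.
Qed.

End power.

(** * The space H^1(R, C), the symplectic form and the Sobolev embedding *)

Section complex_modulus.
Context {R : realType}.
Local Notation Re := (@complex.Re R).
Local Notation Im := (@complex.Im R).
Local Notation modulus := (@Normc.normc R).
Implicit Types z w u : R[i].

Lemma modulus_ge0 z : 0 <= modulus z.
Proof. by case: z => a b; exact: sqrtr_ge0. Qed.

Lemma modulus_sqr z : modulus z ^+ 2 = Re z ^+ 2 + Im z ^+ 2.
Proof. by case: z => a b; rewrite /= sqr_sqrtr// addr_ge0 ?sqr_ge0. Qed.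

Lemma modulus_le z : modulus z <= `|Re z| + `|Im z|.
Proof.
rewrite -(ler_pXn2r (ltn0Sn 1)) ?nnegrE ?modulus_ge0 ?addr_ge0//.
rewrite modulus_sqr -(real_normK (num_real (Re z))) -(real_normK (num_real (Im z))).
by have := mulr_ge0 (normr_ge0 (Re z)) (normr_ge0 (Im z)); nra.
Qed.

Lemma dot_le z w : `|Re z * Re w + Im z * Im w| <= modulus z * modulus w.
Proof.
rewrite -(ler_pXn2r (ltn0Sn 1)) ?nnegrE ?mulr_ge0 ?modulus_ge0//.
rewrite exprMn !modulus_sqr real_normK ?num_real//.
by have := sqr_ge0 (Re z * Im w - Im z * Re w); nra.
Qed.

Lemma modulusB z w : `|modulus z - modulus w| <= modulus (z - w).
Proof.
have h a b : modulus a <= modulus (a - b) + modulus b.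
  by have := le_normcD (a - b) b; rewrite subrK.
rewrite ler_norml; apply/andP; split; last by have := h z w; lra.
by have := h w z; rewrite -opprB normcN; lra.
Qed.

(** The potential (p+1)^-1 |.|^(p+1) on the complex plane has the gradient
    |u|^(p-1) u at u, with a quadratic remainder that is uniform on bounded
    sets. *)
Lemma potential_estimate p M z w u : 1 <= p ->
  modulus z <= M -> modulus w <= M -> modulus u <= M ->
  `|(p + 1)^-1 * (modulus z `^ (p + 1) - modulus w `^ (p + 1)) -
    modulus u `^ (p - 1) * (Re u * Re (z - w) + Im u * Im (z - w))| <=
  (p + 3) * M `^ (p - 1) * (modulus (z - u) + modulus (w - u)) * modulus (z - w).
Proof.
move=> p1 zM wM uM.
have := @potential_modulus _ p M (modulus z) (modulus w) (modulus u) p1.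
rewrite !modulus_ge0 zM wM uM => /(_ isT isT isT).
have hC : modulus u `^ (p - 1) <= M `^ (p - 1).
  by apply: ler_powRl => //; [lra|exact: modulus_ge0].
have C0 := powR_ge0 (modulus u) (p - 1).
have L0 := le_trans C0 hC.
move: hC C0 L0; move: (modulus u `^ (p - 1)) (M `^ (p - 1)) => C L hC C0 L0 h1.
have h2 : (p + 2) * L * (`|modulus z - modulus u| + `|modulus w - modulus u|) *
    `|modulus z - modulus w| <=
    (p + 2) * L * (modulus (z - u) + modulus (w - u)) * modulus (z - w).
  apply: ler_pM; rewrite ?modulusB//.
    by rewrite !mulr_ge0 ?addr_ge0//; lra.
  rewrite ler_wpM2l ?mulr_ge0//; first lra.
  by apply: lerD; exact: modulusB.
have h3 : `|2^-1 * C * ((Re (z - u) + Re (w - u)) * Re (z - w) +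
                      (Im (z - u) + Im (w - u)) * Im (z - w))| <=
    L * (modulus (z - u) + modulus (w - u)) * modulus (z - w).
  rewrite !normrM (ger0_norm C0) (@ger0_norm _ 2^-1) ?invr_ge0//.
  have d1 := dot_le (z - u) (z - w); have d2 := dot_le (w - u) (z - w).
  apply: (@le_trans _ _ (2^-1 * L * ((modulus (z - u) + modulus (w - u)) * modulus (z - w)))).
    apply: ler_pM => //; first by rewrite mulr_ge0 ?invr_ge0.
      by rewrite ler_wpM2l ?invr_ge0.
    rewrite [leRHS]mulrDl; apply: le_trans (lerD d1 d2); apply: le_trans (ler_normD _ _).
    by rewrite le_eqVlt; apply/orP; left; apply/eqP; congr `|_|; ring.
  rewrite -[leRHS]mulrA -[2^-1 * L * _]mulrA ler_piMl ?invf_le1//; last lra.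
  by rewrite !mulr_ge0 ?addr_ge0 ?modulus_ge0.
rewrite (_ : (p + 3) * L = (p + 2) * L + L); last by ring.
rewrite 2!mulrDl.
apply: le_trans (lerD (le_trans h1 h2) h3).
apply: le_trans (ler_normD _ _).
rewrite le_eqVlt; apply/orP; left; apply/eqP; congr `|_|.
rewrite !modulus_sqr; clear -p1; case: z w u => [a b] [c d] [e f] /=; field.
by rewrite gt_eqF//; lra.
Qed.

End complex_modulus.

Section H1_components.
Context {R : realType}.
Local Notation mu := (@lebesgue_measure R).
Implicit Types (u v w z : H1 R) (i j k l : bool).

(** The four real components of an element of H^1: [i] selects the derivative
    instead of the function, [j] the imaginary part instead of the real part. *)
Definition h1c i j u (x : R) : R :=
  (if j then @complex.Im R else @complex.Re R) ((if i then H1_deriv u else H1_fun u) x).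

Lemma H1_pairP u : H1_pair (H1_fun u) (H1_deriv u).
Proof. by have /asboolP := H1_valP (H1_repr u). Qed.

Lemma h1c_Lfun2 i j u : h1c i j u \in Lfun mu 2%:E.
Proof. by have [[? ?] [? ?] _] := H1_pairP u; case: i; case: j. Qed.

Lemma h1c_weak_pair j u : weak_pair (h1c false j u) (h1c true j u).
Proof.
by case: j; [exact: weak_pair_Im (H1_pairP u)|exact: weak_pair_Re (H1_pairP u)].
Qed.

Lemma H1_ae_linear a u v : {ae mu, forall x,
  H1_fun (a *: u + v) x = (a *: (H1_fun u x : Rcomplex R) + H1_fun v x) /\
  H1_deriv (a *: u + v) x = (a *: (H1_deriv u x : Rcomplex R) + H1_deriv v x)}.
Proof.
have : H1_repr (a *: u + v) - (a *: H1_repr u + H1_repr v) \in H1_null.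
  by apply/H1_classP; rewrite H1_classK H1_classD H1_classZ !H1_classK.
move=> /H1_nullP; apply: aeS => x; rewrite raddfB/= !fctE /H1_fun /H1_deriv.
rewrite linearP/= => -[h1 h2]; split; apply/eqP; rewrite -subr_eq0; apply/eqP => //.
by rewrite -[RHS]h1 opprD scalerN.
Qed.

Lemma h1c_ae_linear i j a u v : {ae mu, forall x,
  h1c i j (a *: u + v) x = a * h1c i j u x + h1c i j v x}.
Proof.
have := H1_ae_linear a u v; apply: aeS => x [h1 h2]; rewrite /h1c.
by case: i; rewrite ?h1 ?h2; case: j; rewrite linearP.
Qed.

Lemma H1_normE u : `|u| ^+ 2 =
  \int[mu]_x (h1c false false u x ^+ 2) + \int[mu]_x (h1c false true u x ^+ 2) +
  (\int[mu]_x (h1c true false u x ^+ 2) + \int[mu]_x (h1c true true u x ^+ 2)).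
Proof.
have -> : `|u| = H1_norm u by [].
rewrite sqr_sqrtr ?H1_inner_ge0// H1_innerE /rep_inner.
rewrite -!RintegralD//; try exact: intble_sqr (h1c_Lfun2 _ _ _).
- by apply: eq_Rintegral => x _; rewrite rep_densityE -!expr2.
- by apply: intbleD; exact: intble_sqr (h1c_Lfun2 _ _ _).
- by apply: intbleD; exact: intble_sqr (h1c_Lfun2 _ _ _).
Qed.

Lemma nrm2_h1c i j u : nrm2 (h1c i j u) <= `|u|.
Proof.
rewrite -[leRHS]ger0_norm// -sqrtr_sqr ler_wsqrtr// H1_normE.
have p k l : 0 <= \int[mu]_x (h1c k l u x ^+ 2).
  by apply: Rintegral_ge0 => x _; exact: sqr_ge0.
have := p false false; have := p false true.
have := p true false; have := p true true; clear p.
by case: i; case: j; lra.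
Qed.

Lemma h1c_mul_le i j k l u v :
  \int[mu]_x (`|h1c i j u x| * `|h1c k l v x|) <= `|u| * `|v|.
Proof.
have := Cauchy_Schwarz (Lfun2_abs (h1c_Lfun2 i j u)) (Lfun2_abs (h1c_Lfun2 k l v)).
move=> /(le_trans (ler_norm _)) /le_trans; apply.
have e f : \int[mu]_x (`|f x| ^+ 2) = \int[mu]_x (f x ^+ 2).
  by apply: eq_Rintegral => y _; rewrite real_normK ?num_real.
by rewrite !e; apply: ler_pM; rewrite ?sqrtr_ge0//; exact: nrm2_h1c.
Qed.

Lemma intble_h1c i j k l u v : intble (fun x => h1c i j u x * h1c k l v x).
Proof. by apply: intbleM; exact: h1c_Lfun2. Qed.

Lemma h1c_int_le i j k l u v :
  `|\int[mu]_x (h1c i j u x * h1c k l v x)| <= `|u| * `|v|.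
Proof.
apply: le_trans (h1c_mul_le i j k l u v).
apply: norm_Rintegral_ae.
- exact: intble_measurable (intble_h1c _ _ _ _ _ _).
- by apply: intbleM; apply: Lfun2_abs; exact: h1c_Lfun2.
- by apply/nearW => x; rewrite normrM.
Qed.

Lemma h1c_int_linear i j k l a u v w :
  \int[mu]_x (h1c i j (a *: u + v) x * h1c k l w x) =
  a * \int[mu]_x (h1c i j u x * h1c k l w x) +
  \int[mu]_x (h1c i j v x * h1c k l w x).
Proof.
rewrite -RintegralZl//; last exact: intble_h1c.
rewrite -RintegralD//; [|exact: intbleZ (intble_h1c _ _ _ _ _ _)|exact: intble_h1c].
apply: eq_Rintegral_ae.
- exact: intble_measurable (intble_h1c _ _ _ _ _ _).
- apply: intble_measurable; apply: intbleD; last exact: intble_h1c.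
  exact: intbleZ (intble_h1c _ _ _ _ _ _).
- by have := h1c_ae_linear i j a u v; apply: aeS => x ->; ring.
Qed.

Lemma omegaE u v : omega u v =
  \int[mu]_x (h1c false true u x * h1c false false v x) -
  \int[mu]_x (h1c false false u x * h1c false true v x).
Proof.
rewrite -RintegralB//; [|exact: intble_h1c..].
rewrite /omega /=; apply: eq_Rintegral => x _; rewrite /h1c.
by case: (H1_fun u x) (H1_fun v x) => a b [c d] /=; ring.
Qed.

Lemma omegaC u v : omega u v = - omega v u.
Proof.
rewrite !omegaE opprB; congr (_ - _); apply: eq_Rintegral => x _; exact: mulrC.
Qed.

Lemma omega_linear a u v w : omega (a *: u + v) w = a * omega u w + omega v w.
Proof. by rewrite !omegaE !h1c_int_linear; ring. Qed.

Lemma omega_le u v : `|omega u v| <= 2 * `|u| * `|v|.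
Proof.
rewrite omegaE; apply: le_trans (ler_normB _ _) _.
have := h1c_int_le false true false false u v.
have := h1c_int_le false false false true u v; lra.
Qed.

(** The modulus of the function underlying an element of H^1. *)
Definition h1m u x : R := Normc.normc (H1_fun u x).

Lemma h1mE u x : h1m u x = Num.sqrt (h1c false false u x ^+ 2 + h1c false true u x ^+ 2).
Proof. by rewrite /h1m /h1c; case: (H1_fun u x). Qed.

Lemma h1m_sqr u x : h1m u x ^+ 2 = h1c false false u x ^+ 2 + h1c false true u x ^+ 2.
Proof. by rewrite h1mE sqr_sqrtr// addr_ge0 ?sqr_ge0. Qed.

Lemma measurable_h1m u : measurable_fun setT (h1m u).
Proof.
have -> : h1m u = Num.sqrt \o
    (fun x => h1c false false u x ^+ 2 + h1c false true u x ^+ 2).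
  by apply/funext => x /=; rewrite h1mE.
apply: measurableT_comp.
  by apply: continuous_measurable_fun; exact: sqrt_continuous.
by apply: measurable_funD; apply: measurable_funX; exact: Lfun2_measurable (h1c_Lfun2 _ _ _).
Qed.

Lemma h1m_Lfun2 u : h1m u \in Lfun mu 2%:E.
Proof.
apply: Lfun2_sqr; first exact: measurable_h1m.
have -> : (fun x => h1m u x ^+ 2) =
    (fun x => h1c false false u x ^+ 2 + h1c false true u x ^+ 2).
  by apply/funext => x; rewrite h1m_sqr.
by apply: intbleD; exact: intble_sqr (h1c_Lfun2 _ _ _).
Qed.

Lemma h1m_mul_le u v : \int[mu]_x (h1m u x * h1m v x) <= `|u| * `|v|.
Proof.
have := Cauchy_Schwarz (h1m_Lfun2 u) (h1m_Lfun2 v).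
move=> /(le_trans (ler_norm _)) /le_trans; apply.
have e w : Num.sqrt (\int[mu]_x (h1m w x ^+ 2)) <= `|w|.
  rewrite -[leRHS]ger0_norm// -sqrtr_sqr ler_wsqrtr// H1_normE.
  under eq_Rintegral do rewrite h1m_sqr.
  rewrite RintegralD//; try exact: intble_sqr (h1c_Lfun2 _ _ _).
  by rewrite lerDl addr_ge0// Rintegral_ge0// => x _; exact: sqr_ge0.
by apply: ler_pM; rewrite ?sqrtr_ge0.
Qed.

(** The Sobolev embedding of H^1 into the bounded functions. *)
Lemma H1_sup u : {ae mu, forall x, h1m u x <= 12 * `|u|}.
Proof.
have := weak_pair_bound (h1c_weak_pair false u).
have := weak_pair_bound (h1c_weak_pair true u).
apply: aeS2 => x hi hr.
have := nrm2_h1c false false u; have := nrm2_h1c true false u.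
have := nrm2_h1c false true u; have := nrm2_h1c true true u.
by have := modulus_le (H1_fun u x); rewrite -/(h1m u x); rewrite /h1c in hi hr *; lra.
Qed.

Lemma H1_funB u v : {ae mu, forall x, H1_fun (u - v) x = H1_fun u x - H1_fun v x}.
Proof.
have := H1_ae_linear (-1) v u; apply: aeS => x [+ _].
by rewrite scaleN1r addrC => ->; rewrite scaleN1r addrC.
Qed.

Lemma h1cB i j u v : {ae mu, forall x, h1c i j (u - v) x = h1c i j u x - h1c i j v x}.
Proof.
have := h1c_ae_linear i j (-1) v u; apply: aeS => x.
by rewrite scaleN1r addrC => ->; ring.
Qed.

End H1_components.

(** * The gradient of the energy along a solution *)

Section energy.
Context {R : realType}.
Local Notation mu := (@lebesgue_measure R).
Local Notation modulus := (@Normc.normc R).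
Implicit Types (p : R) (u v w z : H1 R).

(** The integrand of [energy]. *)
Definition energy_density p v (x : R) : R :=
  4^-1 * modulus (H1_deriv v x) ^+ 2 - (p + 1)^-1 * h1m v x `^ (p + 1).

Lemma energy_density_intble p v : 1 <= p -> intble (energy_density p v).
Proof.
move=> p1; apply: intbleB; first apply: intbleZ.
  have -> : (fun x => modulus (H1_deriv v x) ^+ 2) =
      (fun x => h1c true false v x ^+ 2 + h1c true true v x ^+ 2).
    by apply/funext => x; rewrite modulus_sqr.
  by apply: intbleD; exact: intble_sqr (h1c_Lfun2 _ _ _).
apply: intbleZ; set M := 12 * `|v|.
apply: (@intble_le_ae _ _ (fun x => M `^ (p - 1) * h1m v x ^+ 2)).
- by apply: (@measurableT_comp _ _ _ _ _ _ (fun t => t `^ (p + 1)));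
    [exact: measurable_powR|exact: measurable_h1m].
- exact: intbleZ (intble_sqr (h1m_Lfun2 v)).
- have := H1_sup v; apply: aeS => x vM; have v0 : 0 <= h1m v x by exact: modulus_ge0.
  rewrite ger0_norm ?powR_ge0//.
  have -> : h1m v x `^ (p + 1) = h1m v x `^ (p - 1) * h1m v x ^+ 2.
    rewrite -powR_mulrn// -powRD; first by congr (_ `^ _); ring.
    by apply/implyP => /eqP h; exfalso; lra.
  by rewrite ler_wpM2r ?sqr_ge0// ler_powRl// subr_ge0.
Qed.

(** If u and ut satisfy the equation, then the differential of the energy at u is
    - omega(ut, .), in the sense of strict differentiability with a quadratic
    remainder: v and w are independent points near u. *)
Lemma energy_estimate p u ut : 1 <= p -> nls_equation p u ut ->
  exists2 K, 0 <= K & forall v w, `|v - u| <= 1 -> `|w - u| <= 1 ->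
    `|energy p v - energy p w + omega ut (v - w)| <=
      K * (`|v - u| + `|w - u|) * `|v - w|.
Proof.
move=> p1 [uxx uuxx eq].
set M := 12 * (`|u| + 1); set L := (p + 3) * M `^ (p - 1).
have L0 : 0 <= L by rewrite mulr_ge0 ?powR_ge0//; lra.
exists (L + 2^-1) => [|v w vu1 wu1]; first by rewrite addr_ge0 ?invr_ge0.
(* M bounds the moduli of u, v and w almost everywhere. *)
have wr := weak_pair_Re uuxx; have wi := weak_pair_Im uuxx.
set z := v - w.
pose xr x := complex.Re (uxx x); pose xi x := complex.Im (uxx x).
have xr2 : xr \in Lfun mu 2%:E by case: wr.
have xi2 : xi \in Lfun mu 2%:E by case: wi.
have ixr : intble (fun x => xr x * h1c false false z x) by apply: intbleM => //; exact: h1c_Lfun2.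
have ixi : intble (fun x => xi x * h1c false true z x) by apply: intbleM => //; exact: h1c_Lfun2.
have ib i j k l a b := @intble_h1c R i j k l a b.
have pr : \int[mu]_x (xr x * h1c false false z x) =
    - \int[mu]_x (h1c true false z x * h1c true false u x).
  exact: (weak_integration_by_parts wr (h1c_weak_pair false z)).
have pi : \int[mu]_x (xi x * h1c false true z x) =
    - \int[mu]_x (h1c true true z x * h1c true true u x).
  exact: (weak_integration_by_parts wi (h1c_weak_pair true z)).
(* The left-hand side is the integral of G1 + G2 - (G3 + G4) / 2, where G3 and G4
   have integral 0 by parts; the equation then turns the integrand into the second
   order remainders Q of the kinetic energy and S of the potential energy. *)
pose G1 x := energy_density p v x - energy_density p w x.
pose G2 x := h1c false true ut x * h1c false false z x -
             h1c false false ut x * h1c false true z x.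
pose G3 x := xr x * h1c false false z x + h1c true false z x * h1c true false u x.
pose G4 x := xi x * h1c false true z x + h1c true true z x * h1c true true u x.
have iG1 : intble G1 by apply: intbleB; exact: energy_density_intble.
have iG2 : intble G2 by exact: intbleB.
have iG3 : intble G3 by exact: intbleD.
have iG4 : intble G4 by exact: intbleD.
have iG34 : intble (fun x => - 2^-1 * (G3 x + G4 x)) by apply: intbleZ; exact: intbleD.
have iG12 : intble (fun x => G1 x + G2 x) by exact: intbleD.
have -> : energy p v - energy p w + omega ut (v - w) =
    \int[mu]_x ((G1 x + G2 x) + (- 2^-1 * (G3 x + G4 x))).
  have E1 : \int[mu]_x G1 x = energy p v - energy p w.
    by rewrite RintegralB//; exact: energy_density_intble.
  have E2 : \int[mu]_x G2 x = omega ut z by rewrite omegaE RintegralB//; exact: ib.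
  have E3 : \int[mu]_x G3 x = 0.
    by rewrite RintegralD//; [rewrite pr addNr|exact: ib].
  have E4 : \int[mu]_x G4 x = 0.
    by rewrite RintegralD//; [rewrite pi addNr|exact: ib].
  rewrite (RintegralD measurableT iG12 iG34) (RintegralD measurableT iG1 iG2).
  rewrite (RintegralZl _ measurableT (intbleD iG3 iG4)) (RintegralD measurableT iG3 iG4).
  by rewrite E1 E2 E3 E4 addr0 mulr0 addr0.
pose N (a b : H1 R) x := `|h1c true false a x| * `|h1c true false b x| +
                   `|h1c true true a x| * `|h1c true true b x|.
have iN a b : intble (N a b).
  by apply: intbleD; apply: intbleM; apply: Lfun2_abs; exact: h1c_Lfun2.
have iP (a b : H1 R) : intble (fun x => h1m a x * h1m b x).
  by apply: intbleM; exact: h1m_Lfun2.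
have leN a b : \int[mu]_x N a b x <= 2 * `|a| * `|b|.
  rewrite RintegralD//; try by apply: intbleM; apply: Lfun2_abs; exact: h1c_Lfun2.
  have := h1c_mul_le true false true false a b.
  have := h1c_mul_le true true true true a b; lra.
pose B x := (4^-1 * (N (v - u) z x + N (w - u) z x)) +
  (L * (h1m (v - u) x * h1m z x + h1m (w - u) x * h1m z x)).
have iB1 : intble (fun x => N (v - u) z x + N (w - u) z x) by exact: intbleD.
have iB2 : intble (fun x => h1m (v - u) x * h1m z x + h1m (w - u) x * h1m z x).
  exact: intbleD.
have iB : intble B by apply: intbleD; exact: intbleZ.
apply: (@le_trans _ _ (\int[mu]_x B x)); last first.
  rewrite (RintegralD measurableT (intbleZ _ iB1) (intbleZ _ iB2)).
  rewrite (RintegralZl _ measurableT iB1) (RintegralZl _ measurableT iB2).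
  rewrite (RintegralD measurableT (iN _ _) (iN _ _)).
  rewrite (RintegralD measurableT (iP _ _) (iP _ _)).
  have n1 := leN (v - u) z; have n2 := leN (w - u) z.
  have m1 := h1m_mul_le (v - u) z; have m2 := h1m_mul_le (w - u) z.
  have := ler_wpM2l L0 (lerD m1 m2); clear -n1 n2; lra.
apply: norm_Rintegral_ae => //.
  by apply: intble_measurable; exact: intbleD.
have bnd y : `|y - u| <= 1 -> 12 * `|y| <= M.
  move=> yu; rewrite ler_wpM2l// -[y in leLHS](subrK u) addrC.
  by apply: le_trans (ler_normD _ _) _; rewrite lerD2l.
have b1 := bnd v vu1; have b2 := bnd w wu1.
have b3 : 12 * `|u| <= M by rewrite /M; lra.
have := aeI (aeI (aeI (H1_sup v) (H1_sup w)) (aeI (H1_sup u) eq))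
  (aeI (aeI (H1_funB v u) (H1_funB w u)) (aeI (H1_funB v w)
  (aeI (aeI (h1cB true false v u) (h1cB true true v u))
  (aeI (aeI (h1cB true false w u) (h1cB true true w u))
  (aeI (h1cB true false v w) (h1cB true true v w)))))).
apply: aeS => x [[[vM wM] [uM eqx]] [[fvu fwu] [fvw [[d1 d2] [[d3 d4] [d5 d6]]]]]].
have {}vM := le_trans vM b1; have {}wM := le_trans wM b2; have {}uM := le_trans uM b3.
have := potential_estimate p1 vM wM uM.
rewrite -fvu -fwu -fvw -/(h1m v x) -/(h1m w x) -/(h1m u x) -/z -/L.
rewrite -/(h1m z x) -/(h1m (v - u) x) -/(h1m (w - u) x).
set S := (p + 1)^-1 * _ - _ => hS.
set Q := 4^-1 * (h1c true false z x * (h1c true false (v - u) x + h1c true false (w - u) x) +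
  h1c true true z x * (h1c true true (v - u) x + h1c true true (w - u) x)).
have hQ : `|Q| <= 4^-1 * (N (v - u) z x + N (w - u) z x).
  rewrite /Q normrM (@ger0_norm _ 4^-1) ?invr_ge0// ler_wpM2l ?invr_ge0//.
  apply: le_trans (ler_normD _ _) _; rewrite !normrM.
  have t1 := ler_wpM2l (normr_ge0 (h1c true false z x))
    (ler_normD (h1c true false (v - u) x) (h1c true false (w - u) x)).
  have t2 := ler_wpM2l (normr_ge0 (h1c true true z x))
    (ler_normD (h1c true true (v - u) x) (h1c true true (w - u) x)).
  by apply: le_trans (lerD t1 t2) _; rewrite /N; lra.
have -> : G1 x + G2 x + - 2^-1 * (G3 x + G4 x) = Q - S.
  have [e1 e2] : complex.Im (H1_fun ut x) = 2^-1 * xr x +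
        h1m u x `^ (p - 1) * complex.Re (H1_fun u x) /\
      complex.Re (H1_fun ut x) = - 2^-1 * xi x -
        h1m u x `^ (p - 1) * complex.Im (H1_fun u x).
    move: eqx; rewrite -/(h1m u x) /xr /xi.
    move: (h1m u x `^ (p - 1)) => k.
    case: (H1_fun ut x) (uxx x) (H1_fun u x) => [a b] [c d] [e f] /=.
    by move=> [] /= h1 h2; split; lra.
  have m1 : modulus (H1_deriv v x) ^+ 2 = h1c true false v x ^+ 2 + h1c true true v x ^+ 2.
    exact: modulus_sqr.
  have m2 : modulus (H1_deriv w x) ^+ 2 = h1c true false w x ^+ 2 + h1c true true w x ^+ 2.
    exact: modulus_sqr.
  rewrite /G1 /G2 /G3 /G4 /Q /S /energy_density m1 m2 -/z in d5 d6 *.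
  rewrite d1 d2 d3 d4 d5 d6 /h1c e1 e2.
  by field; rewrite gt_eqF//; lra.
apply: le_trans (ler_normB _ _) _; apply: lerD => //.
by apply: le_trans hS _; rewrite le_eqVlt; apply/orP; left; apply/eqP; ring.
Qed.

End energy.

(** * Mean value inequality for curves in H^1(R, C) x R *)

Section derivative_tools.
Context {R : realType}.

Lemma is_derive_linear (V W : normedModType R) (l : V -> W) (C : R)
    (g : R -> V) (r : R) (dg : V) :
  (forall a x y, l (a *: x + y) = a *: l x + l y) ->
  (forall x, `|l x| <= C * `|x|) ->
  is_derive r 1 g dg -> is_derive r 1 (l \o g) (l dg).
Proof.
move=> ll lb [dgr <-].
have lB x y : l (x - y) = l x - l y.
  by rewrite -[x - y]addrC -scaleN1r ll scaleN1r addrC.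
have l0 : l 0 = 0 by rewrite -(subrr 0) lB subrr.
have lZ a x : l (a *: x) = a *: l x by rewrite -[a *: x]addr0 ll l0 addr0.
have cg : h^-1 *: (g (h *: 1 + r) - g r) @[h --> 0^'] --> 'D_1 g r := dgr.
have cl : h^-1 *: ((l \o g) (h *: 1 + r) - (l \o g) r) @[h --> 0^'] --> l ('D_1 g r).
  have C1 : 0 < `|C| + 1 by rewrite ltr_pwDr.
  apply/cvgrPdist_lt => e e0.
  have e1 : 0 < e / (`|C| + 1) by rewrite divr_gt0.
  move/cvgrPdist_lt : cg => /(_ _ e1) cg.
  near=> h; have hh : `|'D_1 g r - h^-1 *: (g (h *: 1 + r) - g r)| < e / (`|C| + 1).
    by near: h.
  rewrite -lB -lZ -lB; apply: le_lt_trans (lb _) _.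
  move: hh; rewrite ltr_pdivlMr// mulrC => hh; apply: le_lt_trans hh.
  by rewrite ler_wpM2r// (le_trans (ler_norm _))// lerDl.
by apply: DeriveDef; [apply/cvg_ex; exists (l ('D_1 g r))|exact: cvg_lim cl].
Unshelve. all: by end_near. Qed.

Section mean_value.
Variables (V : normedModType R) (B : V -> V -> R).
Hypothesis Blin : forall a x y z, B (a *: x + y) z = a * B x z + B y z.
Hypothesis Bnorm : forall x, B x x = `|x| ^+ 2.
Hypothesis Ble : forall x y, `|B x y| <= `|x| * `|y|.

(** The norm comes from the inner product B: the real mean value theorem is applied
    to the product of the curve with its own defect w. *)
Lemma mean_value_inner (g : R -> V) (c : V) (e a b : R) : a <= b -> 0 <= e ->
  (forall r, a <= r <= b -> derivable g r 1 /\ `|'D_1 g r - c| <= e) ->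
  `|g b - g a - (b - a) *: c| <= e * (b - a).
Proof.
move=> ab e0 dg; set w := g b - g a - (b - a) *: c.
have BD x y z : B (x + y) z = B x z + B y z.
  by have := Blin 1 x y z; rewrite scale1r mul1r.
have B0 z : B 0 z = 0 by have := BD 0 0 z; rewrite addr0; lra.
have BZ k x z : B (k *: x) z = k * B x z by rewrite -[k *: x]addr0 Blin B0 addr0.
have BN x z : B (- x) z = - B x z by rewrite -scaleN1r BZ mulN1r.
pose f r := B (g r) w - r * B c w.
have df r : a <= r <= b -> is_derive r 1 f (B ('D_1 g r - c) w).
  move=> /dg[dgr _].
  have h1 : is_derive r 1 ((B ^~ w) \o g) (B ('D_1 g r) w).
    apply: (@is_derive_linear V R (B ^~ w) `|w|).
    - by move=> k x y; exact: Blin.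
    - by move=> x; rewrite mulrC.
    - exact: derivableP.
  have h2 : is_derive r 1 (fun r => r * B c w) (B c w).
    by apply: is_derive_eq; rewrite scaler0 add0r /GRing.scale/= mulr1.
  rewrite BD BN.
  exact: (@is_deriveB _ _ _ ((B ^~ w) \o g) (fun r => r * B c w)).
have [r rab fE] : exists2 r, r \in `[a, b]%R & f b - f a = B ('D_1 g r - c) w * (b - a).
  apply: (@MVT_segment _ f (fun r => B ('D_1 g r - c) w)) => //.
    by move=> r; rewrite in_itv/= => /andP[ar rb]; apply: df; rewrite !ltW.
  apply: continuous_in_subspaceT => r; rewrite inE/= in_itv/= => rab.
  by apply/differentiable_continuous/derivable1_diffP; have [] := df _ rab.
have w2 : `|w| ^+ 2 <= e * (b - a) * `|w|.
  have -> : `|w| ^+ 2 = f b - f a.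
    by rewrite -Bnorm {1}/w !BD !BN BZ /f; ring.
  rewrite fE mulrAC; apply: ler_wpM2r; first by rewrite subr_ge0.
  apply: le_trans (ler_norm _) _; apply: le_trans (Ble _ _) _.
  by rewrite ler_wpM2r//; move: rab; rewrite in_itv/= => /dg[].
have [->|w0] := eqVneq w 0; first by rewrite normr0 mulr_ge0// subr_ge0.
by move: w2; rewrite expr2 ler_pM2r// normr_gt0.
Qed.

End mean_value.

Lemma H1_inner_le (u v : H1 R) : `|H1_inner u v| <= `|u| * `|v|.
Proof.
have -> : `|u| = Num.sqrt (H1_inner u u) by [].
have -> : `|v| = Num.sqrt (H1_inner v v) by [].
rewrite -sqrtrM ?H1_inner_ge0// -sqrtr_sqr ler_wsqrtr//.
exact: (inner_CS H1_innerC H1_inner_lin H1_inner_ge0).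
Qed.

Lemma pair_norm (V : normedModType R) (P : V * R) : `|P| = Num.max `|P.1| `|P.2|.
Proof. by []. Qed.

Lemma pair_norm1 (V : normedModType R) (P : V * R) : `|P.1| <= `|P|.
Proof. by rewrite pair_norm le_max lexx. Qed.

Lemma pair_norm2 (V : normedModType R) (P : V * R) : `|P.2| <= `|P|.
Proof. by rewrite pair_norm le_max lexx orbT. Qed.

Lemma is_derive_fst (g : R -> phase_time R) (r : R) dg :
  is_derive r 1 g dg -> is_derive r 1 (fst \o g) dg.1.
Proof.
apply: (@is_derive_linear (phase_time R) (H1 R) fst 1) => //.
by move=> x; rewrite mul1r pair_norm1.
Qed.

Lemma is_derive_snd (g : R -> phase_time R) (r : R) dg :
  is_derive r 1 g dg -> is_derive r 1 (snd \o g) dg.2.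
Proof.
apply: (@is_derive_linear (phase_time R) R snd 1) => //.
by move=> x; rewrite mul1r pair_norm2.
Qed.

Lemma phase_mean_value (g : R -> phase_time R) (c : phase_time R) (e a b : R) :
  a <= b -> 0 <= e ->
  (forall r, a <= r <= b -> derivable g r 1 /\ `|'D_1 g r - c| <= e) ->
  `|g b - g a - (b - a) *: c| <= e * (b - a).
Proof.
move=> ab e0 dg; rewrite pair_norm ge_max; apply/andP; split.
- apply: (@mean_value_inner _ (@H1_inner R) H1_inner_lin _ H1_inner_le (fst \o g) c.1) => //.
    move=> x; have -> : `|x| = Num.sqrt (H1_inner x x) by [].
    by rewrite sqr_sqrtr ?H1_inner_ge0.
  move=> r rab; have [dr dc] := dg r rab.
  have [d1 d2] := is_derive_fst (derivableP dr); split=> //.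
  by rewrite d2; exact: le_trans (pair_norm1 ('D_1 g r - c)) dc.
- apply: (@mean_value_inner R (fun x y => x * y) _ _ _ (snd \o g) c.2) => //.
  + by move=> k x y z; rewrite /GRing.scale/=; ring.
  + by move=> x; rewrite real_normK ?num_real// expr2.
  + by move=> x y; rewrite normrM.
  + move=> r rab; have [dr dc] := dg r rab.
    have [d1 d2] := is_derive_snd (derivableP dr); split=> //.
    by rewrite d2; exact: le_trans (pair_norm2 ('D_1 g r - c)) dc.
Qed.

End derivative_tools.

(** * Circulation of the action form around small squares *)

(** The estimates of this part only use that om is bilinear, antisymmetric and
    bounded by 2, and nothing on H beyond the stated bounds. *)
Section symplectic.
Context {R : realType} {V : normedModType R}.
Variables (om : V -> V -> R) (H : V -> R).
Hypothesis om_linear : forall a u v w, om (a *: u + v) w = a * om u w + om v w.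
Hypothesis omC : forall u v, om u v = - om v u.
Hypothesis om_le : forall u v, `|om u v| <= 2 * `|u| * `|v|.
Implicit Types u v w : V.
Implicit Types P Q W Z : (V * R)%type.

Let omDl u v w : om (u + v) w = om u w + om v w.
Proof. by rewrite -[u in LHS]scale1r om_linear mul1r. Qed.

Let om0l w : om 0 w = 0.
Proof. by have := omDl 0 0 w; rewrite addr0; lra. Qed.

Let omZl a u w : om (a *: u) w = a * om u w.
Proof. by rewrite -[a *: u]addr0 om_linear om0l addr0. Qed.

Let omNl u w : om (- u) w = - om u w.
Proof. by rewrite -scaleN1r omZl mulN1r. Qed.

Let omDr u v w : om u (v + w) = om u v + om u w.
Proof. by rewrite omC omDl opprD -!omC. Qed.

Let omZr a u w : om u (a *: w) = a * om u w.
Proof. by rewrite omC omZl -mulrN -omC. Qed.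

Let omNr u w : om u (- w) = - om u w.
Proof. by rewrite omC omNl -omC. Qed.

Let om_self u : om u u = 0.
Proof. by have := omC u u; lra. Qed.

Let om_bound u v (a b : R) : `|u| <= a -> `|v| <= b -> `|om u v| <= 2 * a * b.
Proof.
move=> ua vb; apply: le_trans (om_le u v) _.
by rewrite -!mulrA ler_wpM2l// ler_pM.
Qed.

(** The one-form [alpha] for an arbitrary form om and an arbitrary Hamiltonian
    H. *)
Definition action_form P W : R := 2^-1 * om P.1 W.1 - H P.1 * W.2.

Lemma action_form_linear P a W Z :
  action_form P (a *: W + Z) = a * action_form P W + action_form P Z.
Proof. rewrite /action_form /= omDr omZr /GRing.scale /=; ring. Qed.

Lemma action_form_bound P W :
  `|action_form P W| <= (`|P.1| + `|H P.1|) * `|W|.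
Proof.
rewrite /action_form; apply: le_trans (ler_normB _ _) _; rewrite mulrDl.
apply: lerD; last by rewrite normrM ler_wpM2l// pair_norm2.
rewrite normrM (@ger0_norm _ 2^-1) ?invr_ge0//.
have := om_bound (lexx `|P.1|) (pair_norm1 W); lra.
Qed.

Section defects.
Variables (a : V * R) (b : V) (eta : R).
Hypotheses (eta0 : 0 <= eta) (eta1 : eta <= 1).
Local Notation b1 := ((b, 1) : V * R).

(** A common bound, with a margin of 1, for the velocities a in the direction of
    the group parameter and (b, 1) in the direction of time. *)
Definition speed : R := `|a| + `|b1| + 1.

Lemma speed_ge1 : 1 <= speed.
Proof. by rewrite /speed lerDr addr_ge0. Qed.

Lemma speed_l : `|a| + 1 <= speed.
Proof. by have := normr_ge0 b1; rewrite /speed; lra. Qed.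

Lemma speed_r : `|b1| + 1 <= speed.
Proof. by have := normr_ge0 a; rewrite /speed; lra. Qed.

Lemma speedb : `|b| <= speed.
Proof.
have := pair_norm1 b1; rewrite /speed /= => /le_trans; apply.
have := normr_ge0 a; lra.
Qed.

(** The form frozen at P and evaluated on the chord from P to Q, a discrete
    substitute for its integral over a path from P to Q. *)
Definition edge (P Q : V * R) : R := action_form P (Q - P).

Lemma increment_bound (c Z : V * R) s : 0 <= s -> `|c| + 1 <= speed ->
  `|Z - s *: c| <= eta * s -> `|Z| <= speed * s.
Proof.
move=> s0 cs h; rewrite -(subrK (s *: c) Z); apply: le_trans (ler_normD _ _) _.
rewrite normrZ (ger0_norm s0).
have h2 : eta * s <= s by rewrite ler_piMl.
have := ler_wpM2r s0 cs; lra.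
Qed.

(** Along the chord in the direction of time, H is stationary to first order, since
    its differential - om(b, .) vanishes on b. *)
Lemma energy_increment (P Q : V * R) s : 0 <= s ->
  `|Q - P - s *: b1| <= eta * s ->
  `|H Q.1 - H P.1 + om b (Q - P).1| <= eta * `|(Q - P).1| ->
  `|H Q.1 - H P.1| <= 3 * speed * (eta * s).
Proof.
move=> s0 h hH; set Z := (Q - P).1 in hH *.
have zs : `|Z| <= speed * s.
  apply: le_trans (pair_norm1 (Q - P)) _.
  by apply: (increment_bound s0 _ h); have := normr_ge0 a; rewrite /speed; lra.
have ze : `|Z - s *: b| <= eta * s := le_trans (pair_norm1 (Q - P - s *: b1)) h.
have e1 : om b Z = om b (Z - s *: b).
  by rewrite omDr omNr omZr om_self mulr0 subr0.
have w1 : `|om b Z| <= 2 * speed * (eta * s).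
  by rewrite e1; apply: om_bound => //; exact: speedb.
have := ler_wpM2l eta0 zs.
have := ler_normB (H Q.1 - H P.1 + om b Z) (om b Z).
rewrite addrK; lra.
Qed.

(** Moving the base point of the form in the direction of time changes its value on
    the velocity of the trajectory by little. *)
Lemma edge_defect (P Q W : V * R) r : 0 <= r ->
  `|Q - P - r *: b1| <= eta * r -> `|W - b1| <= eta ->
  `|H Q.1 - H P.1 + om b (Q - P).1| <= eta * `|(Q - P).1| ->
  `|action_form Q W - action_form P W| <= 5 * speed ^+ 2 * (eta * r).
Proof.
move=> r0 hQ hW hH.
have hE := energy_increment r0 hQ hH.
have W1 : `|W| <= speed.
  rewrite -(mulr1 speed); apply: (@increment_bound b1) => //.
    by have := normr_ge0 a; rewrite /speed; lra.
  by rewrite scale1r mulr1.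
set Z := (Q - P).1; set e := Z - r *: b; set f := W.1 - b.
have he : `|e| <= eta * r := le_trans (pair_norm1 (Q - P - r *: b1)) hQ.
have hf : `|f| <= eta := le_trans (pair_norm1 (W - b1)) hW.
have -> : action_form Q W - action_form P W =
    2^-1 * (r * om b f + om e W.1) - (H Q.1 - H P.1) * W.2.
  have -> : om e W.1 = om Z W.1 - r * om b W.1.
    by rewrite omDl omNl omZl.
  have -> : om b f = om b W.1 by rewrite omDr omNr om_self subr0.
  have -> : om Z W.1 = om Q.1 W.1 - om P.1 W.1.
    by rewrite /Z /= omDl omNl.
  rewrite /action_form; ring.
have t1 : `|om b f| <= 2 * speed * eta by apply: om_bound => //; exact: speedb.
have t2 : `|om e W.1| <= 2 * (eta * r) * speed.
  by apply: om_bound => //; exact: le_trans (pair_norm1 W) W1.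
have t3 : `|(H Q.1 - H P.1) * W.2| <= 3 * speed * (eta * r) * speed.
  by rewrite normrM; apply: ler_pM => //; exact: le_trans (pair_norm2 W) W1.
have t4 := ler_wpM2l r0 t1.
have s1 := speed_ge1.
have er0 : 0 <= eta * r by rewrite mulr_ge0.
have t5 : speed * (eta * r) <= speed ^+ 2 * (eta * r).
  by rewrite ler_wpM2r// expr2 ler_peMl//; lra.
apply: le_trans (ler_normB _ _) _.
rewrite normrM (@ger0_norm _ 2^-1) ?invr_ge0//.
have := ler_normD (r * om b f) (om e W.1); rewrite normrM (ger0_norm r0).
move: t1 t2 t3 t4 t5; lra.
Qed.

(** The circulation around a small quadrilateral is s^2 times the exterior
    derivative of the form on a and (b, 1), up to O(eta s^2); the latter vanishes when the
    differential of H is - om(b, .). *)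
Lemma square_defect (P00 P10 P01 P11 : V * R) s : 0 <= s ->
  `|P10 - P00 - s *: a| <= eta * s -> `|P11 - P01 - s *: a| <= eta * s ->
  `|P01 - P00 - s *: b1| <= eta * s -> `|P11 - P10 - s *: b1| <= eta * s ->
  `|H P10.1 - H P00.1 + om b (P10 - P00).1| <= eta * `|(P10 - P00).1| ->
  `|H P01.1 - H P00.1 + om b (P01 - P00).1| <= eta * `|(P01 - P00).1| ->
  `|edge P00 P10 + edge P10 P11 - edge P01 P11 - edge P00 P01| <=
    10 * speed ^+ 2 * (eta * s ^+ 2).
Proof.
move=> s0 hX hX' hY hY' hHX hHY.
have ca := speed_l.
have cb := speed_r.
have nX := increment_bound s0 ca hX; have nX' := increment_bound s0 ca hX'.
have nY' := increment_bound s0 cb hY'.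
have hh2 := energy_increment s0 hY hHY.
have s1 := speed_ge1.
set X := (P10 - P00).1 in hHX *; set Y := (P01 - P00).1 in hHY *.
set X' := (P11 - P01).1; set Y' := (P11 - P10).1.
set h1 := H P10.1 - H P00.1 in hHX; set h2 := H P01.1 - H P00.1 in hHY hh2.
set y' := Y' - s *: b; set y := Y - s *: b; set yt := (P11 - P10).2 - s.
have ny' : `|y'| <= eta * s := le_trans (pair_norm1 (P11 - P10 - s *: b1)) hY'.
have ny : `|y| <= eta * s := le_trans (pair_norm1 (P01 - P00 - s *: b1)) hY.
have nyt : `|yt| <= eta * s.
  have := le_trans (pair_norm2 (P11 - P10 - s *: b1)) hY'.
  by rewrite /yt /= /GRing.scale /= mulr1.
have nXX : `|X - X'| <= eta * s + eta * s.
  rewrite (_ : X - X' = (P10 - P00 - s *: a).1 - (P11 - P01 - s *: a).1); last first.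
    rewrite /X /X' /=; move: (P10.1 - P00.1) (P11.1 - P01.1) (s *: a.1) => A B C.
    by rewrite opprB addrA subrK.
  apply: le_trans (ler_normB _ _) _; apply: lerD.
    exact: le_trans (pair_norm1 _) hX.
  exact: le_trans (pair_norm1 _) hX'.
(* The terms of order s^2 cancel, because om X b and om b X' are opposite to first
   order; each term of the right-hand side contains a defect. *)
have E1 : edge P00 P10 + edge P10 P11 - edge P01 P11 - edge P00 P01 =
    2^-1 * om X y' - 2^-1 * om y X' + 2^-1 * (s * om b (X - X')) +
    om b X * yt - (h1 + om b X) * (P11 - P10).2 + h2 * (P11 - P01).2.
  rewrite /edge /action_form /y' /y /yt /h1 /h2 /X /Y /X' /Y' /=.
  rewrite !(omDl, omDr, omNl, omNr, omZl, omZr).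
  rewrite !om_self.
  rewrite ?[om P10.1 P00.1]omC.
  rewrite ?[om P01.1 P00.1]omC.
  rewrite ?[om P11.1 P00.1]omC.
  rewrite ?[om b P00.1]omC.
  rewrite ?[om P01.1 P10.1]omC.
  rewrite ?[om P11.1 P10.1]omC.
  rewrite ?[om b P10.1]omC.
  rewrite ?[om P11.1 P01.1]omC.
  rewrite ?[om b P01.1]omC.
  rewrite ?[om b P11.1]omC.
  by field.
have es0 : 0 <= eta * s by rewrite mulr_ge0.
have X1 : `|X| <= speed * s := le_trans (pair_norm1 (P10 - P00)) nX.
have X'1 : `|X'| <= speed * s := le_trans (pair_norm1 (P11 - P01)) nX'.
have t1 : `|om X y'| <= 2 * (speed * s) * (eta * s) by exact: om_bound.
have t2 : `|om y X'| <= 2 * (eta * s) * (speed * s) by exact: om_bound.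
have t3 : `|om b (X - X')| <= 2 * speed * (eta * s + eta * s).
  by apply: om_bound => //; exact: speedb.
have t4 : `|om b X * yt| <= 2 * speed * (speed * s) * (eta * s).
  by rewrite normrM; apply: ler_pM => //; apply: om_bound => //; exact: speedb.
have t5 : `|(h1 + om b X) * (P11 - P10).2| <= (eta * (speed * s)) * (speed * s).
  rewrite normrM; apply: ler_pM => //.
    by apply: le_trans hHX _; rewrite ler_wpM2l.
  exact: le_trans (pair_norm2 (P11 - P10)) nY'.
have t6 : `|h2 * (P11 - P01).2| <= 3 * speed * (eta * s) * (speed * s).
  by rewrite normrM; apply: ler_pM => //; exact: le_trans (pair_norm2 (P11 - P01)) nX'.
have t3' := ler_wpM2l s0 t3.
have K : speed * (eta * s ^+ 2) <= speed ^+ 2 * (eta * s ^+ 2).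
  by rewrite ler_wpM2r ?mulr_ge0 ?sqr_ge0// expr2 ler_peMl//; lra.
rewrite E1.
apply: le_trans (ler_normD _ _) _; apply: le_trans (lerD (ler_normB _ _) (lexx _)) _.
apply: le_trans (lerD (lerD (ler_normD _ _) (lexx _)) (lexx _)) _.
apply: le_trans (lerD (lerD (lerD (ler_normD _ _) (lexx _)) (lexx _)) (lexx _)) _.
apply: le_trans (lerD (lerD (lerD (lerD (ler_normB _ _) (lexx _)) (lexx _)) (lexx _)) (lexx _)) _.
rewrite !(normrM 2^-1) (@ger0_norm _ 2^-1) ?invr_ge0// (normrM s) (ger0_norm s0).
move: t1 t2 t3' t4 t5 t6 K.
move: `|om X y'| `|om y X'| `|om b (X - X')| `|om b X * yt| => A1 A2 A3 A4.
move: `|(h1 + om b X) * _| `|h2 * _| => A5 A6.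
lra.
Qed.

End defects.

End symplectic.

(** * The charge is stationary *)

Lemma edgeE {R : realType} (V : normedModType R) (om : V -> V -> R) (H : V -> R)
    (P Q : V * R) :
  edge om H P Q = action_form om H P (Q - P).
Proof. by []. Qed.

Lemma subrBB {R : realType} (x y z : R) : x - y = (z - y) - (z - x).
Proof. by ring. Qed.

Lemma subr_exchange {R : realType} (x y z t : R) : x - y - (z - t) = x - z - (y - t).
Proof. by ring. Qed.

Lemma subr_split {R : realType} (x y z : R) : x - z = (x - y) + (y - z).
Proof. by ring. Qed.

Lemma dist_limit {R : realType} (c1 c2 x1 x2 e k : R) :
  `|x1 - c1| <= e / 2 -> `|x2 - c2| <= e / 2 -> `|x2 - x1| <= k -> `|c2 - c1| <= k + e.
Proof.
rewrite !ler_norml => /andP[? ?] /andP[? ?] /andP[? ?].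
by apply/andP; split; lra.
Qed.

Lemma square_telescope {R : realType} (e1 e2 e3 e4 : R) :
  e3 - e1 = (e2 - e4) - (e1 + e2 - e3 - e4).
Proof. by ring. Qed.

(* Unification must not unfold these constants. *)
#[local] Opaque action_form edge speed derive.

Lemma dist_between {R : realType} (t0 d t1 t2 r : R) :
  `|t1 - t0| < d -> `|t2 - t0| < d -> t1 <= r <= t2 -> `|r - t0| < d.
Proof.
rewrite !ltr_norml => /andP[? ?] /andP[? ?] /andP[? ?].
by apply/andP; split; lra.
Qed.

(** Here g s t is the point A(s)(u(t), t), or any family of curves that preserves
    the form along t in the sense of the last clause of [first_order]. *)
Section infinitesimal_conservation.
Context {R : realType} {V : normedModType R}.
Variables (om : V -> V -> R) (H : V -> R).
Hypothesis om_linear : forall a u v w, om (a *: u + v) w = a * om u w + om v w.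
Hypothesis omC : forall u v, om u v = - om v u.
Hypothesis om_le : forall u v, `|om u v| <= 2 * `|u| * `|v|.
Hypothesis mean_value : forall (f : R -> V * R) (c : V * R) (e a b : R),
  a <= b -> 0 <= e ->
  (forall r, a <= r <= b -> derivable f r 1 /\ `|'D_1 f r - c| <= e) ->
  `|f b - f a - (b - a) *: c| <= e * (b - a).
Variables (g : R -> R -> V * R) (t0 : R) (b : V).

Local Notation alpha := (action_form om H).
Local Notation edge := (edge om H).
Local Notation b1 := ((b, 1) : V * R).
Let ds (s t : R) : V * R := 'D_1 (fun s => g s t) s.
Let dt (s t : R) : V * R := 'D_1 (g s) t.

Hypothesis first_order : forall eta, 0 < eta -> exists2 d, 0 < d &
  forall s t, `|s| < d -> `|t - t0| < d ->
  [/\ derivable (fun s => g s t) s 1, `|ds s t - ds 0 t0| <= eta,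
      derivable (g s) t 1, `|dt s t - b1| <= eta &
      alpha (g s t) (dt s t) = alpha (g 0 t) (dt 0 t)].
Hypothesis gradient : exists2 K, 0 <= K &
  forall v w, `|v - (g 0 t0).1| <= 1 -> `|w - (g 0 t0).1| <= 1 ->
    `|H v - H w + om b (v - w)| <=
      K * (`|v - (g 0 t0).1| + `|w - (g 0 t0).1|) * `|v - w|.

Let alpha_lin P k (X Y : V * R) :
  alpha P (k *: X + Y) = k * alpha P X + alpha P Y.
Proof. exact: action_form_linear. Qed.

Let alphaB P (X Y : V * R) : alpha P (X - Y) = alpha P X - alpha P Y.
Proof. by rewrite -[X - Y]addrC -scaleN1r alpha_lin mulN1r addrC. Qed.

Let alpha_derive P (f : R -> V * R) (r : R) df :
  is_derive r 1 f df -> is_derive r 1 (alpha P \o f) (alpha P df).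
Proof.
apply: (@is_derive_linear _ (V * R)%type R (alpha P) (`|P.1| + `|H P.1|)).
  by move=> k X Y; exact: alpha_lin.
by move=> X; exact: action_form_bound.
Qed.

Let C : R := speed (ds 0 t0) b.
Let Phi (s t : R) : R := edge (g 0 t) (g s t).

(** The chords in the direction of time contribute O(eta s^2) to the circulation
    around a square of side s, by invariance, hence so do the other two. *)
Let Phi_step (eta : R) : 0 < eta -> eta <= 1 -> exists2 d, 0 < d &
  forall s t, 0 <= s -> s < d -> `|t - t0| < d -> `|t + s - t0| < d ->
  derivable (fun s => g s t) 0 1 /\
  `|Phi s (t + s) - Phi s t| <= 20 * C ^+ 2 * (eta * s ^+ 2).
Proof.
move=> eta0 eta1.
have [K K0 hK] := gradient.
have [d d0 hd] := first_order eta0.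
have C1 : 1 <= C := speed_ge1 (ds 0 t0) b.
have ca : `|ds 0 t0| + 1 <= C := speed_l (ds 0 t0) b.
have cb : `|b1| + 1 <= C := speed_r (ds 0 t0) b.
have inS s1 s2 t : 0 <= s1 -> s1 <= s2 -> s2 < d -> `|t - t0| < d ->
    `|g s2 t - g s1 t - (s2 - s1) *: ds 0 t0| <= eta * (s2 - s1).
  move=> s10 s12 s2d td.
  apply: (mean_value (f := fun s => g s t)) => //; first exact: ltW.
  move=> r /andP[r1 r2]; have r0 : 0 <= r by lra.
  have rd : `|r| < d by rewrite ger0_norm//; lra.
  by have [e1 e2 _ _ _] := hd r t rd td; split; [exact: e1|exact: e2].
have inT s t1 t2 : 0 <= s -> s < d -> `|t1 - t0| < d -> `|t2 - t0| < d -> t1 <= t2 ->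
    `|g s t2 - g s t1 - (t2 - t1) *: b1| <= eta * (t2 - t1).
  move=> s0 sd t1d t2d t12; apply: (mean_value (f := g s)) => //; first exact: ltW.
  move=> r /andP[r1 r2].
  have rd : `|r - t0| < d by apply: dist_between t1d t2d _; rewrite r1 r2.
  have sd' : `|s| < d by rewrite ger0_norm.
  by have [_ _ e1 e2 _] := hd s r sd' rd; split; [exact: e1|exact: e2].
have pos s t : 0 <= s -> s < d -> `|t - t0| < d ->
    `|(g s t).1 - (g 0 t0).1| <= C * (s + `|t - t0|).
  move=> s0 sd td.
  have t0d : `|t0 - t0| < d by rewrite subrr normr0.
  have h1 : `|g s t - g 0 t| <= C * s.
    apply: (increment_bound (eta := eta) eta1 s0 ca).
    by have := inS 0 s t (lexx _) s0 sd td; rewrite subr0.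
  have h2 : `|g 0 t - g 0 t0| <= C * `|t - t0|.
    have [tt|tt] := leP t0 t.
      apply: (increment_bound (eta := eta) eta1 (normr_ge0 _) cb).
      by rewrite ger0_norm ?subr_ge0//; exact: inT.
    have -> : `|t - t0| = t0 - t by rewrite distrC ger0_norm// subr_ge0 ltW.
    have tt0 : 0 <= t0 - t by rewrite subr_ge0 ltW.
    rewrite distrC; apply: (increment_bound (eta := eta) eta1 tt0 cb).
    exact: (inT 0 t t0 (lexx _) d0 td t0d (ltW tt)).
  apply: le_trans (pair_norm1 (g s t - g 0 t0)) _.
  have -> : g s t - g 0 t0 = (g s t - g 0 t) + (g 0 t - g 0 t0) by rewrite addrA subrK.
  by apply: le_trans (ler_normD _ _) _; rewrite mulrDr lerD.
have K1 : 0 < 2 * K + 1 by lra.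
pose c2 := 2 * C * (2 * K + 1).
have c20 : 0 < c2 by rewrite /c2 mulr_gt0//; lra.
(* With |s| and |t - t0| below eta / c2, all corners are within eta / (2 K + 1) of
   g 0 t0, so that the remainder of the energy is at most eta times the chord. *)
exists (Num.min d (eta / c2)) => [|s t s0].
  by rewrite lt_min d0 divr_gt0.
rewrite !lt_min => /andP[sd se] /andP[td te] /andP[tsd tse].
have d0' : `|0 : R| < d by rewrite normr0.
split; first by have [e1 _ _ _ _] := hd 0 t d0' td; exact: e1.
(* positions stay close to g 0 t0, where H is almost linear *)
have close s' t' : 0 <= s' -> s' < d -> s' < eta / c2 ->
    `|t' - t0| < d -> `|t' - t0| < eta / c2 ->
    `|(g s' t').1 - (g 0 t0).1| <= eta / (2 * K + 1).
  move=> s'0 s'd s'e t'd t'e; apply: le_trans (pos _ _ s'0 s'd t'd) _.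
  have -> : eta / (2 * K + 1) = C * (eta / c2 + eta / c2).
    by rewrite /c2; field; rewrite !gt_eqF//; lra.
  by rewrite ler_wpM2l ?lerD ?ltW//; lra.
have k1 : eta / (2 * K + 1) <= 1 by rewrite ler_pdivrMr; lra.
have enr (P Q : V * R) : `|P.1 - (g 0 t0).1| <= eta / (2 * K + 1) ->
    `|Q.1 - (g 0 t0).1| <= eta / (2 * K + 1) ->
    `|H Q.1 - H P.1 + om b (Q - P).1| <= eta * `|(Q - P).1|.
  move=> hP hQ; apply: le_trans (hK _ _ (le_trans hQ k1) (le_trans hP k1)) _.
  rewrite ler_wpM2r//; apply: le_trans (ler_wpM2l K0 (lerD hQ hP)) _.
  rewrite (_ : K * _ = eta * (2 * K / (2 * K + 1))); last by field; rewrite gt_eqF.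
  by rewrite ger_pMr// ler_pdivrMr//; lra.
set P00 := g 0 t; set P10 := g s t; set P01 := g 0 (t + s); set P11 := g s (t + s).
have dpos : 0 < eta / c2 by rewrite divr_gt0.
have c00 := close 0 t (lexx _) d0 dpos td te.
have c10 := close s t s0 sd se td te.
have c01 := close 0 (t + s) (lexx _) d0 dpos tsd tse.
have tts : t + s - t = s by rewrite addrAC subrr add0r.
have tle : t <= t + s by rewrite lerDl.
(* the four edges, up to invariance *)
have sq : `|edge P00 P10 + edge P10 P11 - edge P01 P11 - edge P00 P01| <=
    10 * C ^+ 2 * (eta * s ^+ 2).
  apply: (square_defect om_linear omC om_le (ltW eta0) eta1 s0).
  - by have := inS 0 s t (lexx _) s0 sd td; rewrite subr0.
  - by have := inS 0 s (t + s) (lexx _) s0 sd tsd; rewrite subr0.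
  - by have := inT 0 t (t + s) (lexx _) d0 td tsd tle; rewrite tts.
  - by have := inT s t (t + s) s0 sd td tsd tle; rewrite tts.
  - exact: (enr P00 P10 c00 c10).
  - exact: (enr P00 P01 c00 c01).
have sides : `|edge P10 P11 - edge P00 P01| <= 10 * C ^+ 2 * (eta * s ^+ 2).
  pose k : R -> R := (alpha P10 \o g s) - (alpha P00 \o g 0).
  have -> : edge P10 P11 - edge P00 P01 = k (t + s) - k t.
    rewrite !edgeE !alphaB /k !fctE /= -/P11 -/P01 -/P10 -/P00.
    exact: subr_exchange.
  have rin r : t <= r <= t + s -> `|r - t0| < d /\ `|r - t0| < eta / c2.
    by move=> rts; split; [exact: dist_between td tsd rts|exact: dist_between te tse rts].
  have sd' : `|s| < d by rewrite ger0_norm.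
  have dk r : t <= r <= t + s ->
      is_derive r 1 k (alpha P10 (dt s r) - alpha P00 (dt 0 r)).
    move=> rts; have [rd _] := rin r rts.
    have [_ _ e1 _ _] := hd s r sd' rd; have [_ _ e2 _ _] := hd 0 r d0' rd.
    have a1 := alpha_derive P10 (derivableP e1); have a2 := alpha_derive P00 (derivableP e2).
    exact (@is_deriveB _ _ _ _ _ _ _ _ _ a1 a2).
  have [r rts kE] : exists2 r, r \in `[t, (t + s)]%R &
      k (t + s) - k t = (alpha P10 (dt s r) - alpha P00 (dt 0 r)) * (t + s - t).
    apply: (@MVT_segment _ k (fun r => alpha P10 (dt s r) - alpha P00 (dt 0 r))) => //.
      by move=> r; rewrite in_itv/= => /andP[r1 r2]; apply: dk; rewrite !ltW.
    apply: continuous_in_subspaceT => r; rewrite inE/= in_itv/= => rts.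
    by apply/differentiable_continuous/derivable1_diffP; have [] := dk _ rts.
  rewrite in_itv/= in rts; have [rd re] := rin r rts; have /andP[r1 r2] := rts.
  have [_ _ _ w1 i1] := hd s r sd' rd; have [_ _ _ w0 _] := hd 0 r d0' rd.
  have rt0 : 0 <= r - t by rewrite subr_ge0.
  have f1 : `|alpha (g s r) (dt s r) - alpha P10 (dt s r)| <=
      5 * C ^+ 2 * (eta * (r - t)).
    apply: (edge_defect om_linear omC om_le (ds 0 t0) (ltW eta0) eta1 rt0 _ w1).
      exact: (inT s t r s0 sd td rd r1).
    exact: (enr P10 (g s r) c10 (close s r s0 sd se rd re)).
  have f0 : `|alpha (g 0 r) (dt 0 r) - alpha P00 (dt 0 r)| <=
      5 * C ^+ 2 * (eta * (r - t)).
    apply: (edge_defect om_linear omC om_le (ds 0 t0) (ltW eta0) eta1 rt0 _ w0).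
      exact: (inT 0 t r (lexx _) d0 td rd r1).
    exact: (enr P00 (g 0 r) c00 (close 0 r (lexx _) d0 dpos rd re)).
  have rs : eta * (r - t) <= eta * s.
    by apply: (ler_wpM2l (ltW eta0)); rewrite lerBlDl.
  have CC0 : 0 <= 5 * C ^+ 2 := mulr_ge0 (ler0n _ 5) (sqr_ge0 C).
  rewrite kE tts normrM (ger0_norm s0).
  rewrite (_ : 10 * C ^+ 2 * (eta * s ^+ 2) =
    (5 * C ^+ 2 * (eta * s) + 5 * C ^+ 2 * (eta * s)) * s); last by ring.
  apply: (ler_wpM2r s0).
  rewrite i1 in f1.
  rewrite (subrBB (alpha P10 (dt s r)) _ (alpha (g 0 r) (dt 0 r))).
  apply: le_trans (ler_normB _ _) _; apply: lerD.
    exact: le_trans f0 (ler_wpM2l CC0 rs).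
  exact: le_trans f1 (ler_wpM2l CC0 rs).
rewrite /Phi -/P00 -/P10 -/P01 -/P11.
rewrite (square_telescope (edge P00 P10) (edge P10 P11) (edge P01 P11) (edge P00 P01)).
apply: le_trans (ler_normB _ _) _; apply: le_trans (lerD sides sq) _.
by rewrite -!mulrDl -natrD.
Qed.

Let charge t : R := alpha (g 0 t) (ds 0 t).

Let Phi_limit t e : derivable (fun s => g s t) 0 1 -> 0 < e ->
  exists2 d, 0 < d & forall s, 0 < s -> s < d -> `|Phi s t / s - charge t| <= e.
Proof.
move=> dg e0; have [dl el] := alpha_derive (g 0 t) (derivableP dg).
have cl : h^-1 *: ((alpha (g 0 t) \o (fun s => g s t)) (h *: 1 + 0) -
     (alpha (g 0 t) \o (fun s => g s t)) 0) @[h --> 0^'] --> charge t.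
  by rewrite /charge -el; exact: dl.
move/cvgrPdist_le : cl => /(_ _ e0).
move=> /nbhs_ballP[d /= d0 hd]; exists d => // s s0 sd.
have := hd s; rewrite -ball_normE /= sub0r normrN gtr0_norm// => /(_ sd).
rewrite gt_eqF// => /(_ isT).
rewrite addr0 scaler1 distrC -alphaB -edgeE /GRing.scale/= mulrC; exact.
Qed.

(** A column of N squares of side s = (t2 - t1) / N bounds the variation of Phi by
    e s (t2 - t1), and Phi s t / s tends to the charge as s tends to 0. *)
Lemma infinitesimal_conservation e : 0 < e -> exists2 d, 0 < d &
  forall t1 t2, `|t1 - t0| < d -> `|t2 - t0| < d -> t1 <= t2 ->
  `|charge t2 - charge t1| <= e * (t2 - t1).
Proof.
move=> e0.
have C1 : 1 <= C := speed_ge1 (ds 0 t0) b.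
have CC : 0 < 20 * C ^+ 2 by rewrite mulr_gt0// exprn_gt0//; lra.
pose eta := Num.min 1 (e / (20 * C ^+ 2)).
have eta0 : 0 < eta by rewrite lt_min ltr01 divr_gt0.
have eta1 : eta <= 1 by rewrite ge_min lexx.
have etae : 20 * C ^+ 2 * eta <= e.
  by rewrite mulrC -ler_pdivlMr// ge_min lexx orbT.
have [d d0 hd] := Phi_step eta0 eta1.
exists d => // t1 t2 t1d t2d; rewrite le_eqVlt => /predU1P[->|t12].
  by rewrite !subrr normr0 mulr0.
apply/ler_addgt0Pr => e' e'0.
have dg t : `|t - t0| < d -> derivable (fun s => g s t) 0 1.
  move=> td; have td' : `|t + 0 - t0| < d by rewrite addr0.
  by have [h _] := hd 0 t (lexx _) d0 td td'; exact: h.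
have e2 : 0 < e' / 2 by rewrite divr_gt0.
have [d1 d10 h1] := Phi_limit (dg _ t1d) e2.
have [d2 d20 h2] := Phi_limit (dg _ t2d) e2.
set m := Num.min d (Num.min d1 d2).
have m0 : 0 < m by rewrite !lt_min d0 d10.
(* N steps of length s lead from t1 to t2 *)
pose N := (Num.trunc ((t2 - t1) / m)).+1.
have N0 : 0 < N%:R :> R by rewrite ltr0n.
pose s := (t2 - t1) / N%:R.
have t210 : 0 < t2 - t1 by rewrite subr_gt0.
have s0 : 0 < s by rewrite divr_gt0.
have sm : s < m.
  rewrite /s ltr_pdivrMr// mulrC -ltr_pdivrMr//.
  exact: truncnS_gt.
move: sm; rewrite /m !lt_min => /andP[sd /andP[sd1 sd2]].
have tN : t1 + N%:R * s = t2 by rewrite /s mulrC divfK ?gt_eqF// addrC subrK.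
have steps n : (n <= N)%N ->
    `|Phi s (t1 + n%:R * s) - Phi s t1| <= n%:R * (e * s ^+ 2).
  elim: n => [|n IH] nN; first by rewrite !mul0r addr0 subrr normr0.
  have lin k : (k <= N)%N -> `|t1 + k%:R * s - t0| < d.
    move=> kN; have ks : k%:R * s <= N%:R * s by rewrite ler_wpM2r ?ler_nat// ltW.
    have k0 : 0 <= k%:R * s by rewrite mulr_ge0// ltW.
    move: t1d t2d; rewrite -tN !ltr_norml => /andP[? ?] /andP[? ?].
    by apply/andP; split; lra.
  have nS : t1 + n.+1%:R * s = t1 + n%:R * s + s by rewrite -natr1 mulrDl mul1r addrA.
  have lS : `|t1 + n%:R * s + s - t0| < d by rewrite -nS; exact: lin.
  have [_ h] := hd s (t1 + n%:R * s) (ltW s0) sd (lin _ (ltnW nN)) lS.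
  have {}h : `|Phi s (t1 + n.+1%:R * s) - Phi s (t1 + n%:R * s)| <= e * s ^+ 2.
    rewrite nS; apply: le_trans h _; rewrite mulrA ler_wpM2r ?sqr_ge0//.
  rewrite (subr_split _ (Phi s (t1 + n%:R * s))) -[in leRHS]natr1 mulrDl mul1r.
  by apply: le_trans (ler_normD _ _) _; rewrite addrC; apply: lerD => //; exact: IH (ltnW nN).
have := steps N (leqnn N); rewrite tN => st.
have st' : `|Phi s t2 / s - Phi s t1 / s| <= e * (t2 - t1).
  rewrite -mulrBl normrM (gtr0_norm (_ : 0 < s^-1)) ?invr_gt0// ler_pdivrMr//.
  apply: le_trans st _; rewrite -tN addrAC subrr add0r le_eqVlt.
  by apply/orP; left; apply/eqP; ring.
have l1 := h1 s s0 sd1; have l2 := h2 s s0 sd2.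
exact: dist_limit l1 l2 st'.
Qed.

End infinitesimal_conservation.

(** * Conservation of the charge *)

(* Unification must not unfold these integrals. *)
#[local] Opaque omega energy derive.

Section trajectories.
Context {R : realType}.
Variables (p : R) (A : R -> phase_time R -> phase_time R) (I : set R) (u : R -> H1 R).
Hypothesis groupA : one_parameter_group A.
Hypothesis invA : forall s, preserves (A s) (alpha p).
Hypothesis regu : regular_along A I u.

Let g (s t : R) : phase_time R := A s (trajectory u t).
Let ds (s t : R) : phase_time R := 'D_1 (fun s => g s t) s.
Let dt (s t : R) : phase_time R := 'D_1 (g s) t.

Lemma orbit0 t : g 0 t = trajectory u t.
Proof. by rewrite /g groupA.1. Qed.

Lemma orbit_velocity t0 : I t0 -> dt 0 t0 = ('D_1 u t0, 1).
Proof.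
move=> It0; have := nbhs_singleton (regu It0) => -[_ d _ _ _].
have g0E : g 0 = trajectory u by apply/funext => t; exact: orbit0.
have dg : is_derive t0 1 (trajectory u) (dt 0 t0).
  by rewrite -g0E; exact: derivableP d.
have [_ e1] := is_derive_fst dg; have [_ e2] := is_derive_snd dg.
rewrite [LHS]surjective_pairing; congr (_, _); first by rewrite -e1.
rewrite -e2; have -> : snd \o trajectory u = id by [].
exact: derive_id.
Qed.

Let near_ball (P : R * R -> Prop) (t0 : R) : (\forall q \near ((0, t0) : R * R), P q) ->
  exists2 d, 0 < d & forall s t, `|s| < d -> `|t - t0| < d -> P (s, t).
Proof.
move=> /nbhs_ballP[d /= d0 h]; exists d => // s t sd td; apply: h; split => /=.
  by rewrite -ball_normE/= sub0r normrN.
by rewrite -ball_normE/= distrC.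
Qed.

(** Near (0, t0) the orbits of the trajectory have velocities close to those at
    (0, t0), and the form is constant in s on their velocities in t. *)
Lemma orbit_first_order (t0 eta : R) : I t0 -> 0 < eta -> exists2 d, 0 < d &
  forall s t, `|s| < d -> `|t - t0| < d ->
  [/\ derivable (fun s => g s t) s 1, `|ds s t - ds 0 t0| <= eta,
      derivable (g s) t 1, `|dt s t - ('D_1 u t0, 1)| <= eta &
      alpha p (g s t) (dt s t) = alpha p (g 0 t) (dt 0 t)].
Proof.
move=> It0 eta0; have rg := regu It0.
have [_ _ c1 c2 _] := nbhs_singleton rg.
move/cvgrPdist_le : c1 => /(_ _ eta0) n1.
move/cvgrPdist_le : c2 => /(_ _ eta0) n2.
have [d d0 h] := near_ball (filterI rg (filterI n1 n2)).
have inv s t : `|s| < d -> `|t - t0| < d ->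
    alpha p (g s t) (dt s t) = alpha p (trajectory u t) ('D_1 (trajectory u) t).
  move=> sd td; have [[_ _ _ _ [dA vA]] _] := h s t sd td.
  by have := invA dA; rewrite /pullback vA.
have d00 : `|0 : R| < d by rewrite normr0.
exists d; first exact: d0.
move=> s t sd td.
have [[d1 d2 _ _ _] [l1 l2]] := h s t sd td.
split.
- exact: d1.
- by rewrite distrC; exact: l1.
- exact: d2.
- by rewrite -(orbit_velocity It0) distrC; exact: l2.
- by rewrite (inv _ _ sd td) (inv _ _ d00 td).
Qed.

End trajectories.

Lemma is_derive0_dist {R : realType} (F : R -> R) (t0 : R) :
  (forall e, 0 < e -> exists2 d, 0 < d & forall t1 t2,
    `|t1 - t0| < d -> `|t2 - t0| < d -> t1 <= t2 ->
    `|F t2 - F t1| <= e * (t2 - t1)) ->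
  is_derive t0 1 F 0.
Proof.
move=> hF.
have cl : h^-1 *: (F (h *: 1 + t0) - F t0) @[h --> 0^'] --> (0 : R).
  apply/cvgrPdist_le => e e0; have [d d0 hd] := hF e e0.
  apply/nbhs_ballP; exists d => //= h; rewrite -ball_normE /= sub0r normrN => hd' h0.
  rewrite sub0r normrN /GRing.scale /= mulr1 normrM normfV ler_pdivrMl ?normr_gt0//.
  have t0d : `|t0 - t0| < d by rewrite subrr normr0.
  have htd : `|h + t0 - t0| < d by rewrite addrK.
  rewrite mulrC; have [hp|hn] := leP 0 h.
    by have := hd _ _ t0d htd; rewrite addrK (ger0_norm hp) lerDr; apply.
  have := hd _ _ htd t0d; rewrite distrC opprD addrCA subrr addr0 (ltr0_norm hn).
  by apply; rewrite gerDr ltW.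
by apply: DeriveDef; [apply/cvg_ex; exists 0|exact: cvg_lim cl].
Qed.

Theorem proposition2 (R : realType) (p : R) (p_ge1 : 1 <= p)
    (A : R -> phase_time R -> phase_time R)
    (groupA : one_parameter_group A)
    (invA : forall s, preserves (A s) (alpha p))
    (I : set R) (openI : open I) (itvI : is_interval I)
    (u : R -> H1 R) (solu : nls_solution p I u) (regu : regular_along A I u) :
  forall t1 t2, I t1 -> I t2 ->
    noether_charge p A (u t1, t1) = noether_charge p A (u t2, t2).
Proof.
pose g (s t : R) : phase_time R := A s (trajectory u t).
pose F t : R := noether_charge p A (u t, t).
have dF t0 : I t0 -> is_derive t0 1 F 0.
  move=> It0; apply: is_derive0_dist => e e0.
  have [_ eq] := solu t0 It0.
  have u0 : (g 0 t0).1 = u t0 by rewrite /g (orbit0 u groupA).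
  have grad : exists2 K, 0 <= K &
    forall v w, `|v - (g 0 t0).1| <= 1 -> `|w - (g 0 t0).1| <= 1 ->
    `|energy p v - energy p w + omega ('D_1 u t0) (v - w)| <=
      K * (`|v - (g 0 t0).1| + `|w - (g 0 t0).1|) * `|v - w|.
    by rewrite u0; exact: energy_estimate.
  have fo eta := orbit_first_order groupA invA regu (eta := eta) It0.
  have [d d0 hd] := infinitesimal_conservation (@omega_linear R) (@omegaC R)
    (@omega_le R) (@phase_mean_value R) fo grad e0.
  exists d; first exact: d0.
  move=> t1 t2 t1d t2d t12.
  have := hd t1 t2 t1d t2d t12.
  by rewrite !(orbit0 u groupA).
have const t1 t2 : I t1 -> I t2 -> t1 <= t2 -> F t1 = F t2.
  move=> I1 I2 t12.
  have sub r : t1 <= r <= t2 -> I r by move=> rt; exact: itvI I1 I2 r rt.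
  have [r _ h] : exists2 r, r \in `[t1, t2]%R & F t2 - F t1 = 0 * (t2 - t1).
    apply: (@MVT_segment _ F (fun=> 0)) => //.
      by move=> r; rewrite in_itv/= => /andP[r1 r2]; apply: dF; apply: sub; rewrite !ltW.
    apply: continuous_in_subspaceT => r; rewrite inE/= in_itv/= => rt.
    by apply/differentiable_continuous/derivable1_diffP; have [] := dF _ (sub _ rt).
  by apply/esym/eqP; rewrite -subr_eq0 h mul0r.
move=> t1 t2 I1 I2; have [t12|/ltW t21] := leP t1 t2; first exact: const.
by apply/esym; exact: const.
Qed.
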